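(* Let $|W|$ be a pencil of plane cubics over $\mathbb{C}$ satisfying conditions (C1) and (C2), whose base point $p$ is a flex for its smooth members. Let $L$ be the tangent line at $p$ to any smooth member of $|W|$. Then the following hold: (i) the pencil $|W|$ has no other reducible member apart from $3L$; (ii) the nodes and cusps of the singular (irreducible) members of $|W|$ are different from $p$; (iii) the possibilities for the singular members of $|W|$ are: (a) $3L$ and two nodal cubics, which occurs if and only if $|W|$ is non-isotrivial; (b) $3L$ and one cuspidal cubic, which occurs if and only if $|W|$ is isotrivial.
   Context: We work over $\mathbb{C}$. A pencil of plane cubics is the linear system $|W|=\mathbb{P}(W)$ associated with a $2$-dimensional linear subspace $W\subset H^0(\mathbb{P}^2,\mathcal{O}_{\mathbb{P}^2}(3))$; its members are the cubic curves defined by nonzero elements of $W$, and its base points are the points common to all members. The conditions are: (C1) there is only one base point (set-theoretically); (C2) the general member is smooth. In this situation the pencil is generated by any smooth member $C$ and by $3L$, where $L$ is the tangent line to $C$ at $p$ and $3L$ denotes the non-reduced cubic defined by $\ell^3=0$ with $\ell=0$ the equation of $L$; the non-reduced curve $3L$ is counted among the reducible members. The pencil is isotrivial if its smooth members are mutually isomorphic, and non-isotrivial otherwise. *)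

(* Defs.v *)
From mathcomp Require Import all_boot all_order all_algebra.
From mathcomp Require Import reals.
From mathcomp Require Export complex mpoly.

Set Implicit Arguments.
Unset Strict Implicit.
Unset Printing Implicit Defensive.
Import GRing.Theory.
Local Open Scope ring_scope.

(* Points of the projective plane are represented by nonzero row vectors and
   plane curves by nonzero forms, both up to [proportional]. *)
Definition proportional (K : fieldType) (V : lmodType K) (u v : V) : Prop :=
  exists2 c : K, c != 0 & u = c *: v.

Section PlaneCurves.
Variable K : closedFieldType.
Implicit Types (F G l : {mpoly K[3]}) (P Q : 'rV[K]_3).

Definition ev F P : K := F.@[fun i => P 0 i].

Definition on_curve F P : Prop := P != 0 /\ ev F P = 0.

Definition singular_at F P : Prop :=
  on_curve F P /\ forall i : 'I_3, ev (F^`M(i)) P = 0.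

Definition singular_curve F : Prop := exists P, singular_at F P.

Definition smooth_curve F : Prop := ~ singular_curve F.

(* The units of {mpoly K[3]} are the nonzero constants. *)
Definition reducible F : Prop :=
  exists G H : {mpoly K[3]},
    [/\ F = G * H, G \isn't a GRing.unit & H \isn't a GRing.unit].

(* [along F P Q] is F(P + tQ) as a polynomial in t. *)
Definition along F P Q : {poly K} :=
  mmap (@polyC K) (fun i => (P 0 i)%:P + Q 0 i *: 'X) F.

Definition is_line l : Prop := l != 0 /\ l \is 1.-homog.

(* For a line l through P: the intersection multiplicity of l and F at P is at
   least m (it is infinite when l is a component of F).  The condition holds
   for all Q on l as soon as it holds for one Q on l other than P. *)
Definition line_mult_ge (m : nat) F l P : Prop :=
  forall Q, ev l Q = 0 -> 'X^m %| along F P Q.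

Definition tangent_line F P : {mpoly K[3]} := \sum_(i < 3) ev (F^`M(i)) P *: 'X_i.

Definition flex F P : Prop :=
  [/\ on_curve F P, ~ singular_at F P & line_mult_ge 3 F (tangent_line F P) P].

(* P is a double point of F whose tangent lines are l1 and l2: the Taylor
   expansion of F at P starts with the quadratic form l1 * l2. *)
Definition double_point F P l1 l2 : Prop :=
  [/\ singular_at F P,
      is_line l1 /\ is_line l2,
      ev l1 P = 0 /\ ev l2 P = 0 &
      forall Q, (along F P Q)`_2 = ev l1 Q * ev l2 Q].

Definition node F P : Prop :=
  exists l1 l2, double_point F P l1 l2 /\ ~ proportional l1 l2.

(* A double point with a single tangent line, which meets F there with
   multiplicity exactly 3. *)
Definition cusp F P : Prop :=
  exists l, [/\ double_point F P l l, line_mult_ge 3 F l P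
              & ~ line_mult_ge 4 F l P].

Definition nodal_cubic F : Prop :=
  [/\ F \is 3.-homog, ~ reducible F &
      exists2 P, node F P & forall Q, singular_at F Q -> proportional Q P].

Definition cuspidal_cubic F : Prop :=
  [/\ F \is 3.-homog, ~ reducible F &
      exists2 P, cusp F P & forall Q, singular_at F Q -> proportional Q P].

(* Morphisms of projective curves, acting on representatives of points: near
   each point P of F, i.e. on a principal Zariski open set {h != 0} containing
   P, phi is given by three forms g_0, g_1, g_2 of the same degree.  They do
   not vanish simultaneously there, since phi Q is nonzero; and since h and
   the g_i are homogeneous, phi automatically sends proportional vectors to
   proportional vectors. *)
Definition curve_morphism F G (phi : 'rV[K]_3 -> 'rV[K]_3) : Prop :=
  (forall P, on_curve F P -> on_curve G (phi P)) /\
  (forall P, on_curve F P ->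
     exists (e d : nat) (h : dhomog 3 K e) (g : 'I_3 -> dhomog 3 K d),
       ev h P != 0 /\
       forall Q, on_curve F Q -> ev h Q != 0 ->
         proportional (phi Q) (\row_i ev (g i) Q)).

Definition isomorphic_curves F G : Prop :=
  exists phi psi : 'rV[K]_3 -> 'rV[K]_3,
    [/\ curve_morphism F G phi, curve_morphism G F psi,
        forall P, on_curve F P -> proportional (psi (phi P)) P
      & forall Q, on_curve G Q -> proportional (phi (psi Q)) Q].

Section Pencil.
(* [dhomog 3 K 3], the space of cubic forms in three variables, is
   H^0(P^2, O(3)). *)
Variable W : {vspace dhomog 3 K 3}.

Definition pencil_member F : Prop :=
  F != 0 /\ exists2 G : dhomog 3 K 3, G \in W & F = G.

Definition base_point P : Prop :=
  P != 0 /\ forall F, pencil_member F -> ev F P = 0.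

Definition only_base_point P : Prop :=
  base_point P /\ forall Q, base_point Q -> proportional Q P.

(* The nonempty Zariski open subsets of the projective line |W| are the
   cofinite ones. *)
Definition general_member (prop : {mpoly K[3]} -> Prop) : Prop :=
  exists s : seq {mpoly K[3]}, forall F, pencil_member F ->
    (forall G, G \in s -> ~ proportional F G) -> prop F.

Definition isotrivial : Prop :=
  forall F G, pencil_member F -> smooth_curve F ->
              pencil_member G -> smooth_curve G -> isomorphic_curves F G.

Definition singular_members_line_two_nodal l : Prop :=
  pencil_member (l ^+ 3) /\
  exists F1 F2, [/\ pencil_member F1 /\ pencil_member F2,
    nodal_cubic F1 /\ nodal_cubic F2, ~ proportional F1 F2 &
    forall F, pencil_member F ->
      (singular_curve F <->
       [\/ proportional F (l ^+ 3), proportional F F1 | proportional F F2])].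

Definition singular_members_line_one_cuspidal l : Prop :=
  pencil_member (l ^+ 3) /\
  exists F1, [/\ pencil_member F1, cuspidal_cubic F1 &
    forall F, pencil_member F ->
      (singular_curve F <-> proportional F (l ^+ 3) \/ proportional F F1)].

End Pencil.
End PlaneCurves.

(* Main.v *)
Require Import Defs.
From mathcomp Require Import all_boot all_order all_algebra.
From mathcomp Require Import reals complex mpoly.
From mathcomp Require Import ring zify.

(** In coordinates where p = (0:1:0) and the flex tangent L at p is Z = 0, a
    smooth member with a flex at p is a Weierstrass cubic
      E_(a,b) : Y^2 Z = X^3 + a X Z^2 + b Z^3      [weierstrass_form].
    A second generator G of the pencil meets it only at p, so G(x, y, 1) has no
    zero on the affine curve.  Elements of the affine coordinate ring have the
    form A(x) + B(x) y, and the norm A^2 - B^2 (x^3 + a x + b) of one without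
    zeros has no root, hence is constant; this forces G to be a combination of
    the cubic and of Z^3                              [cubic_no_affine_zero].
    The members of the pencil are therefore 3L and the cubics E_(a,b) with a
    fixed and b arbitrary                             [pencil_weier, memberP].

    The first two parts, and the list of singular members, are read off this
    normal form.  Every E_(a,b) is irreducible, and it is singular exactly when
    4 a^3 + 27 b^2 = 0, at a point off Z = 0.  For a nonzero this equation has
    two roots b, and each gives a node; for a = 0 its only root is b = 0, and
    E_(0,0) has a cusp.

    When a = 0, rescaling Y and Z identifies all smooth members.  When a is
    nonzero, two members that are not isomorphic are needed, and an isomorphism
    is an arbitrary morphism of curves: neither linear nor compatible with the
    chosen flexes.  It is controlled as follows [isomorphic_weier].
    - The involution sending P to the third intersection point of the line PR
      with the curve is an automorphism of E_(a,b) that exchanges the point at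
      infinity with the reflection of R in the axis y = 0 [weier_move_point].
      Composing with it, one may suppose that the isomorphism fixes the point
      at infinity.
    - It then restricts to the affine curves, where it and its inverse are given
      by regular functions, that is by elements of the coordinate rings
      [locally_regular, morphism_coordinates].
    - The orders of their poles at infinity, measured by degrees of norms, leave
      only x' = c x and y' = d y with d^2 = c^3, so that a' = c^2 a and
      b' = c^3 b                                      [affine_isomorphism].
    In particular E_(a,0) is isomorphic to no E_(a,b) with b nonzero. *)

Set Implicit Arguments.
Unset Strict Implicit.
Unset Printing Implicit Defensive.
Import GRing.Theory Num.Theory.
Local Open Scope ring_scope.

Local Notation i0 := (@Ordinal 3 0 isT).
Local Notation i1 := (@Ordinal 3 1 isT).
Local Notation i2 := (@Ordinal 3 2 isT).

(** * Forms in three variables *)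

Lemma ord3P (T : 'I_3 -> Prop) : T i0 -> T i1 -> T i2 -> forall i, T i.
Proof.
move=> T0 T1 T2 [[|[|[|//]]] lt_i].
- by rewrite (_ : Ordinal lt_i = i0) //; exact: val_inj.
- by rewrite (_ : Ordinal lt_i = i1) //; exact: val_inj.
by rewrite (_ : Ordinal lt_i = i2) //; exact: val_inj.
Qed.

Lemma sum3 (V : nmodType) (f : 'I_3 -> V) :
  \sum_(i < 3) f i = f i0 + f i1 + f i2.
Proof.
rewrite !big_ord_recl big_ord0 addr0 addrA.
by congr (f _ + f _ + f _); exact: val_inj.
Qed.

Lemma prod3 (A : pzSemiRingType) (f : 'I_3 -> A) :
  \prod_(i < 3) f i = f i0 * f i1 * f i2.
Proof.
rewrite !big_ord_recl big_ord0 mulr1 mulrA.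
by congr (f _ * f _ * f _); exact: val_inj.
Qed.

Section MpolyInduction.
Variables (n : nat) (R : comNzRingType).

(** Identities between ring morphisms out of a polynomial ring need only be
    checked on constants and variables; this is how evaluation, restriction to
    a line and linear substitution are compared below. *)
Lemma mpoly_ring_ind (T : {mpoly R[n]} -> Prop) :
  (forall c, T c%:MP) -> (forall i, T 'X_i) ->
  (forall p q, T p -> T q -> T (p + q)) ->
  (forall p q, T p -> T q -> T (p * q)) -> forall p, T p.
Proof.
move=> TC TX TD TM.
elim/mpolyind => [|c m p _ _ Tp]; first by rewrite -(mpolyC0 n R).
apply: (TD) => //; rewrite -mul_mpolyC; apply: (TM); first exact: TC.
rewrite mpolyXE_id; apply: (big_ind T) => [|p1 p2|i _].
- by rewrite -mpolyC1; exact: TC.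
- exact: TM.
by elim: (m i) => [|k IHk]; rewrite ?expr0 -?mpolyC1 ?exprS //; exact: TM.
Qed.

End MpolyInduction.

Section Forms.
Variable K : numClosedFieldType.
Implicit Types (F G H l : {mpoly K[3]}) (P Q : 'rV[K]_3) (c : K).

Definition vec3 (x y z : K) : 'rV[K]_3 := \row_i [:: x; y; z]`_i.

Lemma vec3E0 x y z : vec3 x y z 0 i0 = x. Proof. by rewrite mxE. Qed.
Lemma vec3E1 x y z : vec3 x y z 0 i1 = y. Proof. by rewrite mxE. Qed.
Lemma vec3E2 x y z : vec3 x y z 0 i2 = z. Proof. by rewrite mxE. Qed.
Definition vec3E := (vec3E0, vec3E1, vec3E2).

Lemma row3P P Q :
  P 0 i0 = Q 0 i0 -> P 0 i1 = Q 0 i1 -> P 0 i2 = Q 0 i2 -> P = Q.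
Proof. by move=> e0 e1 e2; apply/rowP; apply: ord3P. Qed.

Lemma vec3_eta P : P = vec3 (P 0 i0) (P 0 i1) (P 0 i2).
Proof. by apply: row3P; rewrite vec3E. Qed.

Lemma vec3_eq0 x y z : (vec3 x y z == 0) = [&& x == 0, y == 0 & z == 0].
Proof.
apply/eqP/and3P => [e | [/eqP-> /eqP-> /eqP->]].
  have E i : vec3 x y z 0 i = 0 by rewrite e mxE.
  by split; apply/eqP; [have := E i0|have := E i1|have := E i2]; rewrite vec3E.
by apply: row3P; rewrite vec3E mxE.
Qed.

Lemma evC c P : ev c%:MP P = c. Proof. exact: mevalC. Qed.
Lemma evX i P : ev 'X_i P = P 0 i. Proof. exact: mevalXU. Qed.
Lemma ev0 P : ev 0 P = 0. Proof. exact: meval0. Qed.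
Lemma ev1 P : ev 1 P = 1. Proof. exact: meval1. Qed.
Lemma evD F G P : ev (F + G) P = ev F P + ev G P. Proof. exact: mevalD. Qed.
Lemma evB F G P : ev (F - G) P = ev F P - ev G P. Proof. exact: mevalB. Qed.
Lemma evN F P : ev (- F) P = - ev F P. Proof. exact: mevalN. Qed.
Lemma evM F G P : ev (F * G) P = ev F P * ev G P. Proof. exact: mevalM. Qed.
Lemma evZ c F P : ev (c *: F) P = c * ev F P. Proof. exact: mevalZ. Qed.
Lemma evXn F P k : ev (F ^+ k) P = ev F P ^+ k.
Proof. by elim: k => [|k IH]; rewrite ?ev1 // !exprS evM IH. Qed.
Definition evE := (evC, evX, ev0, ev1, evD, evB, evN, evM, evZ, evXn).

Lemma alongC c P Q : along c%:MP P Q = c%:P. Proof. exact: mmapC. Qed.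
Lemma alongX i P Q : along 'X_i P Q = (P 0 i)%:P + Q 0 i *: 'X.
Proof. by rewrite /along mmapX mmap1U. Qed.
Lemma along1 P Q : along 1 P Q = 1. Proof. exact: rmorph1. Qed.
Lemma alongD F G P Q : along (F + G) P Q = along F P Q + along G P Q.
Proof. exact: mmapD. Qed.
Lemma alongB F G P Q : along (F - G) P Q = along F P Q - along G P Q.
Proof. exact: mmapB. Qed.
Lemma alongM F G P Q : along (F * G) P Q = along F P Q * along G P Q.
Proof. exact: rmorphM. Qed.
Lemma alongZ c F P Q : along (c *: F) P Q = c *: along F P Q.
Proof. by rewrite /along mmapZ mul_polyC. Qed.
Lemma alongXn F P Q k : along (F ^+ k) P Q = along F P Q ^+ k.
Proof. exact: rmorphXn. Qed.
Definition alongE :=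
  (alongC, alongX, along1, alongD, alongB, alongM, alongZ, alongXn).

Lemma horner_along F P Q t : (along F P Q).[t] = ev F (P + t *: Q).
Proof.
elim/mpoly_ring_ind: F => [c|i|F G EF EG|F G EF EG].
- by rewrite alongC hornerC evC.
- by rewrite alongX hornerD hornerC hornerZ hornerX evX !mxE mulrC.
- by rewrite alongD hornerD EF EG evD.
by rewrite alongM hornerM EF EG evM.
Qed.

Lemma along_coef0 F P Q : (along F P Q)`_0 = ev F P.
Proof. by rewrite -horner_coef0 horner_along scale0r addr0. Qed.

(** The chain rule along a line. It lets singular points and tangent lines be
    handled through [along], which commutes with linear substitutions, instead
    of through partial derivatives. *)
Lemma along_coef1 F P Q :
  (along F P Q)`_1 = \sum_i ev F^`M(i) P * Q 0 i.
Proof.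
elim/mpoly_ring_ind: F => [c|i|F G EF EG|F G EF EG].
- by rewrite alongC coefC big1 // => i _; rewrite mderivC ev0 mul0r.
- rewrite alongX coefD coefC coefZ coefX mulr1 add0r (bigD1 i) //= big1 => [|j].
    by rewrite mderivX mnm1E eqxx scale1r (_ : (U_(i) - U_(i))%MM =
        0%MM) ?mpolyX0 ?ev1 ?mul1r ?addr0 //; apply/mnmP => j;
            rewrite mnmBE mnm0E subnn.
  by move=> ne_ji; rewrite mderivX mnm1E eq_sym (negPf ne_ji) scale0r ev0 mul0r.
- rewrite alongD coefD EF EG -big_split; apply: eq_bigr => i _ /=.
  by rewrite mderivD evD mulrDl.
have conv (p q : {poly K}) : (p * q)`_1 = p`_0 * q`_1 + p`_1 * q`_0.
  by rewrite coefM !big_ord_recl big_ord0 addr0.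
rewrite alongM conv !along_coef0.
rewrite EF EG mulr_sumr mulr_suml -big_split; apply: eq_bigr => i _ /=.
by rewrite mderivM evD !evM; ring.
Qed.

(** The field has characteristic 0, hence is infinite. *)
Lemma poly_ext (p q : {poly K}) : (forall t, p.[t] = q.[t]) -> p = q.
Proof.
move=> e; apply/eqP; rewrite -subr_eq0; apply: contraT => nz.
pose s := [seq i%:R : K | i <- iota 0 (size (p - q))].
have /(max_poly_roots nz) : all (root (p - q)) s.
  by apply/allP => t _; rewrite rootE hornerD hornerN e subrr.
rewrite map_inj_uniq ?iota_uniq; last by move=> i j /eqP;
    rewrite eqr_nat => /eqP.
by rewrite size_map size_iota ltnn => /(_ isT).
Qed.

Lemma ev_homogZ d F c P : F \is d.-homog -> ev F (c *: P) = c ^+ d * ev F P.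
Proof.
move=> /dhomogP homF; rewrite /ev !mevalE mulr_sumr.
apply: eq_big_seq => m /homF <- /=; rewrite mulrCA mdegE -prodrXr -big_split /=.
by congr (_ * _); apply: eq_bigr => i _; rewrite !mxE exprMn.
Qed.

(** The form whose value at P is that of F at P *m M: substitution of linear
    forms for the variables, that is the pullback of F by the linear map M. *)
Definition lsub (M : 'M[K]_3) F : {mpoly K[3]} :=
  F \mPo [tuple \sum_i M i j *: 'X_i | j < 3].

Lemma lsubC M c : lsub M c%:MP = c%:MP.
Proof. exact: comp_mpolyC. Qed.
Lemma lsubX M j : lsub M 'X_j = \sum_i M i j *: 'X_i.
Proof. by rewrite /lsub comp_mpolyXU -tnth_nth tnth_mktuple. Qed.
Lemma lsubD M F G : lsub M (F + G) = lsub M F + lsub M G.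
Proof. exact: comp_mpolyD. Qed.
Lemma lsubB M F G : lsub M (F - G) = lsub M F - lsub M G.
Proof. exact: comp_mpolyB. Qed.
Lemma lsubN M F : lsub M (- F) = - lsub M F.
Proof. exact: comp_mpolyN. Qed.
Lemma lsubM M F G : lsub M (F * G) = lsub M F * lsub M G.
Proof. exact: rmorphM. Qed.
Lemma lsubZ M c F : lsub M (c *: F) = c *: lsub M F.
Proof. exact: comp_mpolyZ. Qed.
Lemma lsubXn M F k : lsub M (F ^+ k) = lsub M F ^+ k.
Proof. exact: rmorphXn. Qed.
Definition lsubE := (lsubC, lsubD, lsubB, lsubN, lsubM, lsubZ, lsubXn, lsubX).

Lemma lsubX_coord M j P : ev (lsub M 'X_j) P = (P *m M) 0 j.
Proof.
rewrite lsubX sum3 !evE mxE sum3.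
by rewrite (mulrC (M i0 j)) (mulrC (M i1 j)) (mulrC (M i2 j)).
Qed.

Lemma along_lsub M F P Q : along (lsub M F) P Q = along F (P *m M) (Q *m M).
Proof.
elim/mpoly_ring_ind: F => [c|i|F G EF EG|F G EF EG].
- by rewrite lsubC !alongC.
- rewrite lsubX !alongX sum3 !alongE !mxE !sum3.
  by rewrite !polyCD !polyCM -!mul_polyC !polyCD !polyCM; ring.
- by rewrite lsubD !alongD EF EG.
by rewrite lsubM !alongM EF EG.
Qed.

Lemma ev_lsub M F P : ev (lsub M F) P = ev F (P *m M).
Proof. by rewrite -(along_coef0 F _ (0 *m M)) -along_lsub along_coef0. Qed.

Lemma lsub_lsub M N F : lsub M (lsub N F) = lsub (M *m N) F.
Proof.
elim/mpoly_ring_ind: F => [c|i|F G EF EG|F G EF EG].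
- by rewrite !lsubC.
- rewrite !lsubX !sum3 !lsubE !sum3 !mxE !sum3 -!mul_mpolyC.
  by rewrite !mpolyCD !mpolyCM; ring.
- by rewrite !lsubD EF EG.
by rewrite !lsubM EF EG.
Qed.

Lemma lsub1 F : lsub 1%:M F = F.
Proof.
elim/mpoly_ring_ind: F => [c|i|F G EF EG|F G EF EG].
- by rewrite lsubC.
- rewrite lsubX (bigD1 i) //= mxE eqxx scale1r big1 ?addr0 // => j /negPf ne.
  by rewrite mxE ne scale0r.
- by rewrite lsubD EF EG.
by rewrite lsubM EF EG.
Qed.

Lemma lsubK M F : M \in unitmx -> lsub M (lsub (invmx M) F) = F.
Proof. by move=> uM; rewrite lsub_lsub mulmxV // lsub1. Qed.
Lemma lsubVK M F : M \in unitmx -> lsub (invmx M) (lsub M F) = F.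
Proof. by move=> uM; rewrite lsub_lsub mulVmx // lsub1. Qed.

Lemma dhomog_comp k (t : k.-tuple {mpoly K[3]}) d e (F : {mpoly K[k]}) :
  (forall i, tnth t i \is d.-homog) -> F \is e.-homog ->
  F \mPo t \is (e * d).-homog.
Proof.
move=> homt /dhomogP homF; rewrite comp_mpolyEX big_seq.
apply: rpred_sum => m /homF <-; apply: rpredZ; rewrite comp_mpolyX.
rewrite /= mdegE big_distrl /=.
elim/big_rec2: _ => [|i a p _ IH]; first exact: dhomog1.
by apply: dhomogM => //; rewrite mulnC; apply: dhomogMn.
Qed.

Lemma lsub_homog M d F : F \is d.-homog -> lsub M F \is d.-homog.
Proof.
rewrite -{2}(muln1 d); apply: dhomog_comp => j; rewrite tnth_mktuple.
by apply: rpred_sum => i _; apply: rpredZ; rewrite dhomogX /= mdeg1.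
Qed.

Definition mon (i j k : nat) : 'X_{1..3} := [multinom of [tuple i; j; k]].

Lemma mon_eta (m : 'X_{1..3}) : m = mon (m i0) (m i1) (m i2).
Proof. by apply/mnmP; apply: ord3P; rewrite multinomE. Qed.

Lemma mpolyX_mon i j k :
  'X_[mon i j k] = 'X_i0 ^+ i * 'X_i1 ^+ j * 'X_i2 ^+ k :> {mpoly K[3]}.
Proof. by rewrite mpolyXE_id prod3. Qed.

Lemma cubicP F : F \is 3.-homog -> exists c : nat -> nat -> nat -> K, F =
  (c 3 0 0)%N *: 'X_i0 ^+ 3 + (c 2 1 0)%N *: ('X_i0 ^+ 2 * 'X_i1)
  + (c 2 0 1)%N *: ('X_i0 ^+ 2 * 'X_i2) + (c 1 2 0)%N *: ('X_i0 * 'X_i1 ^+ 2)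
  + (c 1 1 1)%N *: ('X_i0 * 'X_i1 * 'X_i2) + (c 1 0 2)%N *: ('X_i0 * 'X_i2 ^+ 2)
  + (c 0 3 0)%N *: 'X_i1 ^+ 3 + (c 0 2 1)%N *: ('X_i1 ^+ 2 * 'X_i2)
  + (c 0 1 2)%N *: ('X_i1 * 'X_i2 ^+ 2) + (c 0 0 3)%N *: 'X_i2 ^+ 3.
Proof.
move=> homF; exists (fun i j k => F@_(mon i j k)).
pose tr : seq (nat * nat * nat) := [:: (3, 0, 0); (2, 1, 0); (2, 0, 1);
  (1, 2, 0); (1, 1, 1); (1, 0, 2); (0, 3, 0); (0, 2, 1); (0, 1, 2);
      (0, 0, 3)]%N.
pose mont (t : nat * nat * nat) := mon t.1.1 t.1.2 t.2.
have tr_cover i j k : (i + j + k == 3)%N -> (i, j, k) \in tr.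
  by move: i j k => [|[|[|[|i]]]] [|[|[|[|j]]]] [|[|[|[|k]]]].
have mont_inj : injective mont.
  move=> [[i j] k] [[i' j'] k'] /mnmP e.
  have e0 : i = i' by have := e i0.
  have e1 : j = j' by have := e i1.
  have e2 : k = k' by have := e i2.
  by rewrite e0 e1 e2.
have FE : F = \sum_(t <- tr) F@_(mont t) *: 'X_[mont t].
  apply/mpolyP => m; rewrite raddf_sum /=.
  have [m_s | m_s] := boolP ((m i0, m i1, m i2) \in tr).
    have mE : m = mont (m i0, m i1, m i2) by exact: mon_eta.
    rewrite (bigD1_seq (m i0, m i1, m i2)) //= -mE.
    rewrite mcoeffZ mcoeffX eqxx mulr1 big1 ?addr0 // => t' ne.
    by rewrite mcoeffZ mcoeffX mE (inj_eq mont_inj) (negPf ne) mulr0.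
  rewrite big1_seq => [|t /= s_t]; last first.
    rewrite mcoeffZ mcoeffX; case: eqP => [e|_]; last by rewrite mulr0.
    by rewrite -e /mont !multinomE /= -!surjective_pairing s_t in m_s.
  apply: (dhomog_nemf_coeff homF); apply: contra m_s => /=.
  by rewrite mdegE sum3; exact: tr_cover.
have sum_tr (V : nmodType) (f : nat * nat * nat -> V) : \sum_(t <- tr) f t =
    f (3, 0, 0)%N + f (2, 1, 0)%N + f (2, 0, 1)%N + f (1, 2, 0)%N + f (1, 1,
        1)%N
    + f (1, 0, 2)%N + f (0, 3, 0)%N + f (0, 2, 1)%N + f (0, 1, 2)%N + f (0, 0,
        3)%N.
  by rewrite /tr !big_cons big_nil addr0 !addrA.
rewrite {1}FE sum_tr /mont /= !mpolyX_mon.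
by rewrite !expr0 !expr1 !mulr1 !mul1r.
Qed.

End Forms.

(** * Invariance under proportionality and linear substitutions *)

Section Proportional.
Variables (K : fieldType) (V : lmodType K).
Implicit Types u v w : V.

Lemma proportional_refl u : proportional u u.
Proof. by exists 1; rewrite ?oner_eq0 ?scale1r. Qed.

Lemma proportional_sym u v : proportional u v -> proportional v u.
Proof.
by case=> c nz_c ->; exists c^-1; rewrite ?invr_eq0 // scalerA mulVf // scale1r.
Qed.

Lemma proportional_trans u v w :
  proportional u v -> proportional v w -> proportional u w.
Proof.
case=> c nz_c -> [d nz_d ->]; exists (c * d); rewrite ?mulf_neq0 //.
by rewrite scalerA.
Qed.

Lemma proportionalZ (c : K) v : c != 0 -> proportional (c *: v) v.
Proof. by exists c. Qed.

End Proportional.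

Section Substitution.
Variable K : numClosedFieldType.
Implicit Types (F G H l : {mpoly K[3]}) (P Q : 'rV[K]_3) (c : K).
Implicit Types M : 'M[K]_3.

(** The partial derivatives are the coefficients of t along the coordinate
    directions. *)
Lemma singular_atP F P : singular_at F P <->
  on_curve F P /\ forall Q, (along F P Q)`_1 = 0.
Proof.
split=> -[FP dF]; split=> //.
  by move=> Q; rewrite along_coef1 big1 // => i _; rewrite dF mul0r.
move=> i; have := dF (delta_mx 0 i);
    rewrite along_coef1 (bigD1 i) //= big1 ?addr0.
  by rewrite mxE !eqxx mulr1.
by move=> j ne_ji; rewrite mxE eqxx (negPf ne_ji) mulr0.
Qed.

Lemma on_curveZ c F P : c != 0 -> on_curve (c *: F) P <-> on_curve F P.
Proof.
move=> nz_c; split=> -[nzP FP]; split=> //; last by rewrite evZ FP mulr0.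
by move/eqP: FP; rewrite evZ mulf_eq0 (negPf nz_c) => /eqP.
Qed.

Lemma singular_at_scale c F P : c != 0 -> singular_at F P ->
    singular_at (c *: F) P.
Proof.
move=> nz_c /singular_atP[FP dF]; apply/singular_atP; split.
  exact/on_curveZ.
by move=> Q; rewrite alongZ coefZ dF mulr0.
Qed.

Lemma singular_curve_proportional F G :
  proportional F G -> singular_curve G -> singular_curve F.
Proof. by case=> c nz_c -> [P sP]; exists P; apply: singular_at_scale. Qed.

Lemma root_nonunit G P : ev G P = 0 -> G \isn't a GRing.unit.
Proof.
move=> GP; apply/negP => /divrr /(congr1 (fun p => ev p P)).
by rewrite evM GP mul0r ev1 => /eqP; rewrite eq_sym oner_eq0.
Qed.

Lemma reducible_proportional F G : proportional F G -> reducible G ->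
    reducible F.
Proof.
case=> c nz_c -> [A [B [-> nuA nuB]]]; exists (c%:MP * A), B.
split=> //; first by rewrite -mulrA mul_mpolyC.
by rewrite unitrM negb_and nuA orbT.
Qed.

Section Invertible.
Variable M : 'M[K]_3.
Hypothesis uM : M \in unitmx.

Lemma mulmx_unit_eq0 P : (P *m M == 0) = (P == 0).
Proof.
by apply/eqP/eqP => [e | ->]; rewrite ?mul0mx // -(mulmxK uM P) e mul0mx.
Qed.

Lemma proportional_mulmx P Q : proportional (P *m M) (Q *m M) <->
    proportional P Q.
Proof.
split=> -[c nz_c e]; exists c => //; last by rewrite e -scalemxAl.
by rewrite -(mulmxK uM P) e -scalemxAl mulmxK.
Qed.

Lemma lsub_eq0 F : (lsub M F == 0) = (F == 0).
Proof.
apply/eqP/eqP => [e | ->]; last by rewrite -(mpolyC0 3 K) lsubC.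
by rewrite -(lsubVK F uM) e -(mpolyC0 3 K) lsubC.
Qed.

Lemma proportional_lsub F G : proportional (lsub M F) (lsub M G) <->
    proportional F G.
Proof.
split=> -[c nz_c e]; exists c => //; last by rewrite e lsubZ.
by rewrite -(lsubVK F uM) e lsubZ lsubVK.
Qed.

Lemma on_curve_lsub F P : on_curve (lsub M F) P <-> on_curve F (P *m M).
Proof. by rewrite /on_curve ev_lsub mulmx_unit_eq0. Qed.

Lemma singular_at_lsub F P : singular_at (lsub M F) P <->
    singular_at F (P *m M).
Proof.
split=> /singular_atP[/on_curve_lsub FP dF]; apply/singular_atP; split=> // Q.
  by rewrite -(mulmxKV uM Q) -along_lsub.
by rewrite along_lsub.
Qed.

Lemma singular_curve_lsub F : singular_curve (lsub M F) <-> singular_curve F.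
Proof.
split=> -[P]; first by move=> /singular_at_lsub sP; exists (P *m M).
by move=> sP; exists (P *m invmx M); apply/singular_at_lsub; rewrite mulmxKV.
Qed.

Lemma lsub_unit F : (lsub M F \is a GRing.unit) = (F \is a GRing.unit).
Proof.
have unit_lsub N G : G \is a GRing.unit -> lsub N G \is a GRing.unit.
  by rewrite /lsub => uG; rewrite rmorph_unit.
by apply/idP/idP => [/(unit_lsub (invmx M))|];
    [rewrite lsubVK|exact: unit_lsub].
Qed.

Lemma reducible_lsub F : reducible (lsub M F) <-> reducible F.
Proof.
split=> -[A [B [eF nuA nuB]]]; last first.
  by exists (lsub M A), (lsub M B); rewrite !lsub_unit eF lsubM.
exists (lsub (invmx M) A), (lsub (invmx M) B).
by rewrite -(lsub_unit (lsub _ A)) -(lsub_unit (lsub _ B)) !lsubK // -lsubM -eF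
  lsubVK.
Qed.

Lemma line_mult_ge_lsub m F l P :
  line_mult_ge m (lsub M F) (lsub M l) P <-> line_mult_ge m F l (P *m M).
Proof.
split=> mult Q lQ; last by rewrite along_lsub; apply: mult; rewrite -ev_lsub.
rewrite -(mulmxKV uM Q) -along_lsub; apply: mult.
by rewrite ev_lsub mulmxKV.
Qed.

Lemma double_point_lsub F P l1 l2 : double_point F (P *m M) l1 l2 ->
  double_point (lsub M F) P (lsub M l1) (lsub M l2).
Proof.
case=> sP [[nz1 hom1] [nz2 hom2]] l12P quad; split.
- exact/singular_at_lsub.
- by split; split; rewrite ?lsub_eq0 //; apply: lsub_homog.
- by rewrite !ev_lsub.
by move=> Q; rewrite along_lsub !ev_lsub.
Qed.

Lemma node_lsub F P : node F (P *m M) -> node (lsub M F) P.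
Proof.
case=> l1 [l2 [dP not_prop]]; exists (lsub M l1), (lsub M l2).
by split; [exact: double_point_lsub | rewrite proportional_lsub].
Qed.

Lemma cusp_lsub F P : cusp F (P *m M) -> cusp (lsub M F) P.
Proof.
case=> l [dP m3 m4]; exists (lsub M l).
by split; [exact: double_point_lsub | |]; rewrite line_mult_ge_lsub.
Qed.

Lemma singular_point_lsub F P :
  (forall Q, singular_at F Q -> proportional Q (P *m M)) ->
  forall Q, singular_at (lsub M F) Q -> proportional Q P.
Proof. by move=> uP Q /singular_at_lsub/uP/proportional_mulmx. Qed.

Lemma nodal_cubic_lsub F : nodal_cubic F -> nodal_cubic (lsub M F).
Proof.
case=> homF irrF [P nP uP]; split; rewrite ?reducible_lsub //.
  exact: lsub_homog.
exists (P *m invmx M); first by apply: node_lsub; rewrite mulmxKV.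
by apply: singular_point_lsub; rewrite mulmxKV.
Qed.

Lemma cuspidal_cubic_lsub F : cuspidal_cubic F -> cuspidal_cubic (lsub M F).
Proof.
case=> homF irrF [P nP uP]; split; rewrite ?reducible_lsub //.
  exact: lsub_homog.
exists (P *m invmx M); first by apply: cusp_lsub; rewrite mulmxKV.
by apply: singular_point_lsub; rewrite mulmxKV.
Qed.

End Invertible.
End Substitution.

(** * Weierstrass cubics *)

Section Weierstrass.
Variable K : numClosedFieldType.
Implicit Types (F G H l : {mpoly K[3]}) (P Q : 'rV[K]_3) (a b c : K).

Lemma homog_X i : ('X_i : {mpoly K[3]}) \is 1.-homog.
Proof. by rewrite dhomogX /= mdeg1. Qed.

(** The cubic Y^2 Z = X^3 + a X Z^2 + b Z^3, whose only point with Z = 0 is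
    the flex (0:1:0). *)
Definition weier a b : {mpoly K[3]} :=
  'X_i1 ^+ 2 * 'X_i2 - 'X_i0 ^+ 3 - a *: ('X_i0 * 'X_i2 ^+ 2) - b *: 'X_i2 ^+ 3.

Lemma weier_homog a b : weier a b \is 3.-homog.
Proof.
have X1 := homog_X; do !apply: rpredB; do ?apply: rpredZ.
- by apply: (@dhomogM _ _ _ 2 _ 1) => //; exact: (@dhomogMn _ _ _ 1 _ 2).
- exact: (@dhomogMn _ _ _ 1 _ 3).
- by apply: (@dhomogM _ _ _ 1 _ 2) => //; exact: (@dhomogMn _ _ _ 1 _ 2).
exact: (@dhomogMn _ _ _ 1 _ 3).
Qed.

Lemma ev_weier a b P : ev (weier a b) P =
  P 0 i1 ^+ 2 * P 0 i2 - P 0 i0 ^+ 3 - a * P 0 i0 * P 0 i2 ^+ 2 - b * P 0 i2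
      ^+ 3.
Proof. by rewrite !evE; ring. Qed.

Lemma ev_weier3 a b x y z : ev (weier a b) (vec3 x y z) =
  y ^+ 2 * z - x ^+ 3 - a * x * z ^+ 2 - b * z ^+ 3.
Proof. by rewrite ev_weier !vec3E. Qed.

Lemma on_weierE a b x y z : on_curve (weier a b) (vec3 x y z) ->
  y ^+ 2 * z - x ^+ 3 - a * x * z ^+ 2 - b * z ^+ 3 = 0.
Proof. by case=> _; rewrite ev_weier3. Qed.

Lemma on_weier_infty a b x y : on_curve (weier a b) (vec3 x y 0) ->
    x = 0 /\ y != 0.
Proof.
move=> EP; have /eqP : x ^+ 3 = 0 by rewrite -[RHS]oppr0 -(on_weierE EP); ring.
rewrite expf_eq0 /= => /eqP x_0.
split=> //; apply: contraTneq EP.1 => ->.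
by rewrite x_0 vec3_eq0 eqxx.
Qed.

Definition poly3 (c0 c1 c2 c3 : K) : {poly K} :=
  c0%:P + c1%:P * 'X + c2%:P * 'X^2 + c3%:P * 'X^3.

Lemma coef_poly3 c0 c1 c2 c3 k :
  (poly3 c0 c1 c2 c3)`_k = [:: c0; c1; c2; c3]`_k.
Proof.
rewrite /poly3 !coefD coefC !coefCM !coefX !coefXn.
by case: k => [|[|[|[|k]]]] /=; rewrite ?mulr1 ?mulr0 ?addr0 ?add0r // nth_nil.
Qed.

Lemma horner_poly3 c0 c1 c2 c3 t :
  (poly3 c0 c1 c2 c3).[t] = c0 + c1 * t + c2 * t ^+ 2 + c3 * t ^+ 3.
Proof. by rewrite /poly3 !hornerE. Qed.

Lemma along_weier a b x y z u v w :
  along (weier a b) (vec3 x y z) (vec3 u v w) =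
  poly3 (y ^+ 2 * z - x ^+ 3 - a * x * z ^+ 2 - b * z ^+ 3)
   (2 * y * v * z + y ^+ 2 * w - 3 * x ^+ 2 * u
      - a * (u * z ^+ 2 + 2 * x * z * w) - 3 * b * z ^+ 2 * w)
   (v ^+ 2 * z + 2 * y * v * w - 3 * x * u ^+ 2
      - a * (2 * u * z * w + x * w ^+ 2) - 3 * b * z * w ^+ 2)
   (v ^+ 2 * w - u ^+ 3 - a * u * w ^+ 2 - b * w ^+ 3).
Proof.
apply: poly_ext => t; rewrite horner_along horner_poly3 ev_weier !mxE /=.
by ring.
Qed.

(** A point with Z = 0 is (0:1:0), where the derivative in Z is nonzero; off
    Z = 0 the derivatives vanish when y = 0 and x / z is a double root of
    X^3 + a X + b. *)
Lemma singular_weierP a b x y z : singular_at (weier a b) (vec3 x y z) <->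
  [/\ z != 0, y = 0, 3 * x ^+ 2 + a * z ^+ 2 = 0 & 2 * a * x + 3 * b * z = 0].
Proof.
split=> [/singular_atP[[nzP]] _ dF | [nz_z -> ex ez]].
  have := dF (vec3 1 0 0); have := dF (vec3 0 1 0); have := dF (vec3 0 0 1).
  rewrite !along_weier !coef_poly3 /= => e3 e2 e1.
  have ex : 3 * x ^+ 2 + a * z ^+ 2 = 0 by rewrite -[RHS]oppr0 -e1; ring.
  have yz0 : y * z = 0.
    by apply/eqP; rewrite -(mulrI_eq0 _ (mulfI (_ : 2 != 0))) ?pnatr_eq0 // -e2;
       apply/eqP; ring.
  have nz_z : z != 0.
    apply: contraNneq nzP => z0; move: ex e3; rewrite z0 => ex e3.
    have x0 : x = 0.
      apply/eqP; rewrite -sqrf_eq0; apply/eqP.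
      by apply: (mulfI (_ : 3 != 0)); rewrite ?pnatr_eq0 // mulr0 -ex; ring.
    have y0 : y = 0 by apply/eqP; rewrite -sqrf_eq0 -e3 x0; apply/eqP; ring.
    by rewrite x0 y0 vec3_eq0 eqxx.
  have y0 : y = 0 by apply: (mulIf nz_z); rewrite yz0 mul0r.
  split=> //; apply: (mulIf nz_z); rewrite mul0r -[RHS]oppr0 -e3 y0; ring.
apply/singular_atP; split.
  split; first by rewrite vec3_eq0 !negb_and nz_z !orbT.
  rewrite ev_weier3; apply: (mulfI (_ : 3 != 0)); first by rewrite pnatr_eq0.
  transitivity (- x * (3 * x ^+ 2 + a * z ^+ 2) - z ^+ 2 * (2 * a * x + 3 * b
      * z)).
    by ring.
  by rewrite ex ez; ring.
move=> Q; rewrite (vec3_eta Q) along_weier coef_poly3 /=.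
move: (Q 0 i0) (Q 0 i1) (Q 0 i2) => u v w.
transitivity (- u * (3 * x ^+ 2 + a * z ^+ 2) - w * z * (2 * a * x + 3 * b *
    z)).
  by ring.
by rewrite ex ez; ring.
Qed.

(** The discriminant of X^3 + a X + b, up to sign. *)
Definition disc a b := 4 * a ^+ 3 + 27 * b ^+ 2.

(** The last two equations of [singular_weierP] are quadratic and linear in
    (x : z), and [disc] is their resultant; the double root is -3b / 2a when a
    is nonzero. *)
Lemma singular_curve_weier a b : singular_curve (weier a b) <-> disc a b = 0.
Proof.
split=> [[P] | d0].
  rewrite (vec3_eta P) => /singular_weierP[]; move: (P 0 i0) (P 0 i2) => x z.
  move=> nz_z _ ex ez; apply: (mulfI nz_z); apply: (mulfI nz_z); rewrite !mulr0.
  transitivity (4 * a ^+ 2 * (3 * x ^+ 2 + a * z ^+ 2)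
    + (3 * (3 * b * z - 2 * a * x)) * (2 * a * x + 3 * b * z)).
    by rewrite /disc; ring.
  by rewrite ex ez; ring.
have [a0 | nz_a] := eqVneq a 0.
  exists (vec3 0 0 1); apply/singular_weierP; rewrite a0 oner_eq0; split=> //.
    by ring.
  have: b ^+ 2 = 0.
    apply: (mulfI (_ : 27 != 0)); first by rewrite pnatr_eq0.
    by rewrite mulr0 -d0 /disc a0; ring.
  by move/eqP; rewrite sqrf_eq0 => /eqP->; ring.
exists (vec3 (- 3 * b) 0 (2 * a)); apply/singular_weierP; split=> //.
- by rewrite mulf_neq0 // pnatr_eq0.
- by rewrite -d0 /disc; ring.
by ring.
Qed.

Lemma mpoly_deg1 G : (msize G <= 2)%N -> exists g0 g1 g2 g3,
  G = g0%:MP + g1 *: 'X_i0 + g2 *: 'X_i1 + g3 *: 'X_i2.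
Proof.
move=> szG; exists G@_0, G@_U_(i0), G@_U_(i1), G@_U_(i2).
suff {1}-> : G = (G@_0)%:MP + \sum_i G@_U_(i) *: 'X_i.
  by rewrite sum3 !addrA.
apply/mpolyP => m; rewrite mcoeffD mcoeffC raddf_sum /=.
have [lt_m2 | ] := ltnP (mdeg m) 2; last first.
  move=> le2m; rewrite memN_msupp_eq0; last first.
    by apply: msize_mdeg_ge; apply: leq_trans le2m.
  rewrite big1 ?addr0 => [|i _]; last first.
    rewrite mcoeffZ mcoeffX; case: eqP le2m => [<-|_ _]; last by rewrite mulr0.
    by rewrite mdeg1.
  by case: eqP le2m => [->|_ _]; rewrite ?mdeg0 ?mulr0.
have [m0 | nz_m] := eqVneq m 0%MM.
  rewrite m0 mulr1 big1 ?addr0 // => i _.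
  by rewrite mcoeffZ mcoeffX mnm1_eq0 mulr0.
have /mdeg1P[i /eqP mi] : mdeg m == 1%N.
  by move: nz_m lt_m2; rewrite -mdeg_eq0; case: (mdeg m) => [|[|]].
rewrite mulr0 add0r mi (bigD1 i) //= big1 => [|j ne_ji].
  by rewrite addr0 mcoeffZ mcoeffX eqxx mulr1.
by rewrite mcoeffZ mcoeffX eq_mnm1 (negPf ne_ji) mulr0.
Qed.

Lemma weier_neq0 a b : weier a b != 0.
Proof.
apply/eqP => e; suff /eqP : (1 : K) = 0 by rewrite oner_eq0.
by rewrite -[RHS]oppr0 -(ev0 (vec3 1 0 0)) -e ev_weier3; ring.
Qed.

(** A factor of degree one would vanish on an affine plane of the space of
    triples (x, y, z), on which the cubic would vanish as well. Solving the
    equation of the plane for y, x or z gives a contradiction on suitable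
    points. *)
Lemma weier_no_linear_factor a b G H : weier a b = G * H -> msize G != 2%N.
Proof.
move=> eF; apply/eqP => szG.
have [g0 [g1 [g2 [g3 eG]]]] := mpoly_deg1 (eq_leq szG).
have on_plane x y z : g0 + g1 * x + g2 * y + g3 * z = 0 ->
    y ^+ 2 * z - x ^+ 3 - a * x * z ^+ 2 - b * z ^+ 3 = 0.
  by move=> G0; rewrite -ev_weier3 eF evM eG !evE !vec3E G0 mul0r.
have absurd (n : nat) : n.+1%:R = 0 :> K -> False by move/eqP;
    rewrite pnatr_eq0.
have [g2_0 | nz_g2] := eqVneq g2 0; last first.
  apply: (absurd 0%N); rewrite -[RHS]oppr0 -(on_plane 1 (- (g0 + g1) / g2) 0).
    by ring.
  by field.
have [g1_0 | nz_g1] := eqVneq g1 0; last first.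
  pose x := - (g0 + g3) / g1.
  have Gx : g0 + g1 * x + g2 * 0 + g3 * 1 = 0 by rewrite /x; field.
  have Gx' : g0 + g1 * x + g2 * 1 + g3 * 1 = 0 by rewrite g2_0 /x; field.
  apply: (absurd 0%N); rewrite -(subrr 0) -{1}(on_plane _ _ _ Gx').
  by rewrite -(on_plane _ _ _ Gx); ring.
have [g3_0 | nz_g3] := eqVneq g3 0; last first.
  pose z := - g0 / g3.
  have Gx x : g0 + g1 * x + g2 * 0 + g3 * z = 0.
    by rewrite g1_0 g2_0 /z; field.
  pose f x := 0 ^+ 2 * z - x ^+ 3 - a * x * z ^+ 2 - b * z ^+ 3.
  have f0 x : f x = 0 by apply: on_plane (Gx x).
  apply: (absurd 5%N); transitivity (2 * f 1 - f 2 - f 0);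
      first by rewrite /f; ring.
  by rewrite !f0; ring.
move: szG; rewrite eG g1_0 g2_0 g3_0 !scale0r !addr0 msizeC.
by case: eqP.
Qed.

(** The degrees of two nonconstant factors of a cubic are 1 and 2. *)
Lemma weier_irreducible a b : ~ reducible (weier a b).
Proof.
case=> G [H [eF nuG nuH]].
have nz_GH : G * H != 0 by rewrite -eF weier_neq0.
have [nzG nzH] : G != 0 /\ H != 0 by apply/andP; rewrite -negb_or -mulf_eq0.
have sz_ge2 (A : {mpoly K[3]}) : A != 0 -> A \isn't a GRing.unit ->
    (2 <= msize A)%N.
  move=> nzA; apply: contraR; rewrite -leqNgt leq_eqVlt ltnS leqn0.
  rewrite msize_poly_eq0 (negPf nzA) orbF => /msize_poly1P[c nz_c ->].
  by apply: rmorph_unit; rewrite unitfE.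
have szF : msize (weier a b) = 4%N.
  have := dhomog_uniq (weier_neq0 a b) (weier_homog a b)
    (dhomog_msize (weier_homog a b)).
  by move=> e; rewrite (mpolySpred _ (weier_neq0 a b)) -e.
have absurd (m n : nat) : (m + n).-1 = 4%N -> (1 < m)%N -> (1 < n)%N ->
    m != 2%N -> n != 2%N -> False.
  by move: m n => [|[|[|[|m]]]] [|[|[|[|n]]]]; rewrite ?addSn ?addnS.
apply: (absurd (msize G) (msize H)); rewrite ?sz_ge2 //.
- by rewrite -msizeM // -eF.
- exact: weier_no_linear_factor eF.
by apply: (@weier_no_linear_factor a b H G); rewrite mulrC.
Qed.

Lemma reducible_cube l P : P != 0 -> ev l P = 0 -> reducible (l ^+ 3).
Proof.
move=> nzP lP; exists l, (l ^+ 2); rewrite exprS; split=> //.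
  exact: (@root_nonunit _ _ P).
by apply: (@root_nonunit _ _ P); rewrite evXn lP expr0n.
Qed.

Lemma is_line_ev l P : l \is 1.-homog -> ev l P != 0 -> is_line l.
Proof. by move=> hom; split=> //; apply: contraNneq H => ->; rewrite ev0. Qed.

(** The cubic polynomial is (X - c)^2 (X + 2c): near its double root c the
    curve is Y^2 = 3c (X - c)^2, and the two tangents are defined by a square
    root of 3c. *)
Lemma nodal_cubic_weier c : c != 0 ->
  nodal_cubic (weier (- 3 * c ^+ 2) (2 * c ^+ 3)).
Proof.
move=> nz_c; split; [exact: weier_homog | exact: weier_irreducible |].
have nz3 : (3 : K) != 0 by rewrite pnatr_eq0.
have nz2 : (2 : K) != 0 by rewrite pnatr_eq0.
exists (vec3 c 0 1); last first.
  move=> Q; rewrite (vec3_eta Q) => /singular_weierP[nz_z -> _ ez].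
  exists (Q 0 i2) => //; apply: row3P; rewrite !mxE /= ?mulr0 ?mulr1 //.
  apply: (mulfI (_ : 2 * (- 3 * c ^+ 2) != 0)).
    by rewrite !mulf_neq0 // ?oppr_eq0 // sqrf_eq0.
  by apply/eqP; rewrite -subr_eq0 -ez; apply/eqP; ring.
pose s := sqrtC (3 * c).
have s2 : s ^+ 2 = 3 * c by rewrite sqrtCK.
have nz_s : s != 0 by rewrite -sqrf_eq0 s2 mulf_neq0.
pose l (e : K) : {mpoly K[3]} := 'X_i1 - e *: ('X_i0 - c *: 'X_i2).
have evl e P : ev (l e) P = P 0 i1 - e * (P 0 i0 - c * P 0 i2) by rewrite !evE.
have line_l e : is_line (l e).
  apply: (@is_line_ev _ (vec3 0 1 0)).
    by rewrite /l; do ![apply: rpredB | apply: rpredZ | exact: homog_X].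
  by rewrite evl !vec3E mulr0 subrr mulr0 subr0 oner_eq0.
exists (l s), (l (- s)); split; last first.
  case=> k nz_k e; have e1 := congr1 (fun F => ev F (vec3 0 1 0)) e.
  have := congr1 (fun F => ev F (vec3 1 0 0)) e.
  move: e1; rewrite /= !evZ !evl !vec3E !mulr0 !subr0 !mulr0 !subr0 !mulr1 =>
      <-.
  rewrite mul1r !sub0r => /eqP; rewrite -subr_eq0 opprK -opprD oppr_eq0.
  by rewrite -mulr2n mulrn_eq0 (negPf nz_s).
split=> //.
- by apply/singular_weierP; split=> //; rewrite ?oner_eq0 //; ring.
- by rewrite !evl !vec3E; split; ring.
move=> Q; rewrite {1}(vec3_eta Q) along_weier coef_poly3 /= !evl.
move: (Q 0 i0) (Q 0 i1) (Q 0 i2) => u v w.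
transitivity (v ^+ 2 - s ^+ 2 * (u - c * w) ^+ 2); last by ring.
by rewrite s2; ring.
Qed.

Lemma cuspidal_cubic_weier : cuspidal_cubic (weier 0 0).
Proof.
split; [exact: weier_homog | exact: weier_irreducible |].
have nz3 : (3 : K) != 0 by rewrite pnatr_eq0.
exists (vec3 0 0 1); last first.
  move=> Q; rewrite (vec3_eta Q) => /singular_weierP[nz_z -> ex _].
  have -> : Q 0 i0 = 0.
    apply/eqP; rewrite -sqrf_eq0; apply/eqP; apply: (mulfI nz3).
    by rewrite mulr0 -ex; ring.
  by exists (Q 0 i2) => //; apply: row3P; rewrite !mxE /= ?mulr0 ?mulr1.
have alongY Q : ev 'X_i1 Q = 0 ->
    along (weier 0 0) (vec3 0 0 1) Q = (- Q 0 i0 ^+ 3)%:P * 'X^3.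
  rewrite evX => Q1; rewrite (vec3_eta Q) Q1 along_weier vec3E0 /poly3.
  by apply: poly_ext => t; rewrite !hornerE /=; ring.
exists 'X_i1; split; first split.
- by apply/singular_weierP; split=> //; rewrite ?oner_eq0 //; ring.
- by split; apply: (@is_line_ev _ (vec3 0 1 0));
    rewrite ?homog_X // evX vec3E oner_eq0.
- by rewrite !evX vec3E.
- move=> Q; rewrite {1}(vec3_eta Q) along_weier coef_poly3 /= !evX.
  by ring.
- by move=> Q /alongY->; rewrite dvdp_mull.
move/(_ (vec3 1 0 0)); rewrite evX vec3E => /(_ erefl).
rewrite alongY ?evX ?vec3E // expr1n => /dvdp_leq.
rewrite size_polyXn size_Cmul ?oppr_eq0 ?oner_eq0 // size_polyXn.
by rewrite -size_poly_eq0 size_Cmul ?oppr_eq0 ?oner_eq0 // size_polyXn => /(_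
    isT).
Qed.

End Weierstrass.

(** * Morphisms of plane curves *)

Section CurveMorphisms.
Variable K : numClosedFieldType.
Implicit Types (F G H l : {mpoly K[3]}) (P Q : 'rV[K]_3) (c : K).
Implicit Types (phi psi : 'rV[K]_3 -> 'rV[K]_3).

Lemma ev_comp d (h : {mpoly K[3]}) (g : 'I_3 -> dhomog 3 K d) P :
  ev (h \mPo [tuple (g i : {mpoly K[3]}) | i < 3]) P = ev h (\row_i ev (g i) P).
Proof.
rewrite /ev comp_mpoly_meval; apply: meval_eq => i.
by rewrite tnth_mktuple mxE.
Qed.

Lemma row_evZ d (g : 'I_3 -> {mpoly K[3]}) c P : (forall i, g i \is d.-homog) ->
  \row_i ev (g i) (c *: P) = c ^+ d *: \row_i ev (g i) P.
Proof. by move=> hom_g; apply/rowP => i;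
    rewrite !mxE (ev_homogZ _ _ (hom_g i)). Qed.

Lemma ev_homog_neq0 d F P Q :
  F \is d.-homog -> proportional P Q -> ev F P != 0 -> ev F Q != 0.
Proof.
move=> homF [c nz_c ->]; rewrite (ev_homogZ _ _ homF) mulf_eq0 negb_or.
by case/andP.
Qed.

Lemma on_curve_proportional d F P Q : F \is d.-homog ->
  proportional P Q -> on_curve F Q -> on_curve F P.
Proof.
move=> homF [c nz_c ->] [nzQ FQ]; split;
    first by rewrite scaler_eq0 negb_or nz_c.
by rewrite (ev_homogZ _ _ homF) FQ mulr0.
Qed.

(** Local expressions compose by substitution, and the open set is cut out by
    the product of h with the pullback of h'. *)
Lemma curve_morphism_comp F G H phi psi :
  curve_morphism F G phi -> curve_morphism G H psi ->
  curve_morphism F H (psi \o phi).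
Proof.
move=> [FG locF] [GH locG]; split=> [P FP | P FP]; first exact/GH/FG.
have [e [d [h [g [hP phiE]]]]] := locF P FP.
have [e' [d' [h' [g' [hP' psiE]]]]] := locG _ (FG P FP).
pose t := [tuple (g i : {mpoly K[3]}) | i < 3].
have hom_t i : tnth t i \is d.-homog by rewrite tnth_mktuple dhomog_is_dhomog.
have hom_h : (h : {mpoly K[3]}) * (h' \mPo t) \is (e + e' * d).-homog.
  by apply: dhomogM; rewrite ?dhomog_is_dhomog ?dhomog_comp ?dhomog_is_dhomog.
have hom_g i : (g' i : {mpoly K[3]}) \mPo t \is (d' * d).-homog.
  by apply: dhomog_comp; rewrite ?dhomog_is_dhomog.
exists _, _, (DHomog hom_h), (fun i => DHomog (hom_g i));
    rewrite /= evM mulf_neq0 //=.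
  split=> // Q FQ; rewrite evM mulf_eq0 negb_or => /andP[hQ].
  rewrite ev_comp => h'gQ; have gE := phiE Q FQ hQ.
  have h'Q : ev h' (phi Q) != 0.
    apply: ev_homog_neq0 h'gQ; first exact: dhomog_is_dhomog.
    exact: proportional_sym.
  apply: proportional_trans (psiE _ (FG _ FQ) h'Q) _.
  have [c nz_c ->] := gE.
  rewrite (row_evZ _ _ (fun i => dhomog_is_dhomog (g' i))); exists (c ^+ d');
      rewrite ?expf_neq0 //.
  by congr (_ *: _); apply/rowP => i; rewrite !mxE ev_comp.
rewrite ev_comp; apply: ev_homog_neq0 hP'; first exact: dhomog_is_dhomog.
exact: phiE.
Qed.

Lemma curve_morphism_proportional F G phi P Q : curve_morphism F G phi ->
  on_curve F P -> on_curve F Q -> proportional P Q ->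
  proportional (phi P) (phi Q).
Proof.
move=> [_ locF] FP FQ PQ; have [e [d [h [g [hP phiE]]]]] := locF P FP.
have hQ : ev h Q != 0 by apply: ev_homog_neq0 hP => //; exact: dhomog_is_dhomog.
apply: proportional_trans (phiE P FP hP) _; apply/proportional_sym.
apply: proportional_trans (phiE Q FQ hQ) _.
have [c nz_c ->] := proportional_sym PQ.
rewrite (row_evZ _ _ (fun i => dhomog_is_dhomog (g i))).
by apply: proportionalZ; rewrite expf_neq0.
Qed.

Lemma isomorphic_curves_sym F G : isomorphic_curves F G ->
    isomorphic_curves G F.
Proof. by case=> phi [psi [Mphi Mpsi phiK psiK]]; exists psi, phi. Qed.

Lemma isomorphic_curves_trans F G H :
  isomorphic_curves F G -> isomorphic_curves G H -> isomorphic_curves F H.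
Proof.
case=> f [f' [Mf Mf' fK f'K]] [g [g' [Mg Mg' gK g'K]]].
exists (g \o f), (f' \o g'); split.
- exact: curve_morphism_comp Mf Mg.
- exact: curve_morphism_comp Mg' Mf'.
- move=> P FP /=; apply: proportional_trans (fK P FP).
  have GfP := Mf.1 _ FP; have GgP := Mg'.1 _ (Mg.1 _ GfP).
  exact: (curve_morphism_proportional Mf' GgP GfP (gK _ GfP)).
move=> Q HQ /=; apply: proportional_trans (g'K Q HQ).
have GgQ := Mg'.1 _ HQ; have GfQ := Mf.1 _ (Mf'.1 _ GgQ).
exact: (curve_morphism_proportional Mg GfQ GgQ (f'K _ GgQ)).
Qed.

Lemma curve_morphism_mulmx F G (N : 'M[K]_3) :
  (forall P, on_curve F P -> on_curve G (P *m N)) ->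
  curve_morphism F G (mulmxr N).
Proof.
move=> FG; split=> // P FP.
have hom_g i : lsub N 'X_i \is 1.-homog by apply/lsub_homog/homog_X.
have hom1 : (1 : {mpoly K[3]}) \is 0.-homog by exact: dhomog1.
exists 0%N, 1%N, (DHomog hom1), (fun i => DHomog (hom_g i)).
rewrite /= ev1 oner_eq0; split=> // Q _ _.
suff -> : \row_i ev (lsub N 'X_i) Q = Q *m N by exact: proportional_refl.
by apply/rowP => i; rewrite mxE lsubX_coord.
Qed.

Lemma isomorphic_curves_proportional F G : proportional F G ->
    isomorphic_curves F G.
Proof.
case=> c nz_c ->; exists (mulmxr 1%:M), (mulmxr 1%:M); split.
- by apply: curve_morphism_mulmx => P /(on_curveZ _ _ nz_c); rewrite mulmx1.
- by apply: curve_morphism_mulmx => P GP; rewrite mulmx1; apply/on_curveZ.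
- by move=> P _ /=; rewrite !mulmx1; exact: proportional_refl.
by move=> P _ /=; rewrite !mulmx1; exact: proportional_refl.
Qed.

Lemma isomorphic_curves_lsub (M : 'M[K]_3) F :
  M \in unitmx -> isomorphic_curves (lsub M F) F.
Proof.
move=> uM; exists (mulmxr M), (mulmxr (invmx M)); split=> [||P _|P _] /=.
- by apply: curve_morphism_mulmx => P /(on_curve_lsub uM).
- by apply: curve_morphism_mulmx => P FP; apply/(on_curve_lsub uM);
    rewrite mulmxKV.
- by rewrite mulmxK //; exact: proportional_refl.
by rewrite mulmxKV //; exact: proportional_refl.
Qed.

End CurveMorphisms.

(** * The automorphism exchanging a point with the flex at infinity *)

Section ThirdPoint.
Variable K : numClosedFieldType.
Implicit Types (F G : {mpoly K[3]}) (P Q : 'rV[K]_3).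
Variables a x0 y0 : K.

Let b := y0 ^+ 2 - x0 ^+ 3 - a * x0.
Let E := weier a b.
Hypothesis disc_neq0 : disc a b != 0.
Let R := vec3 x0 y0 1.

Local Notation X := ('X_i0 : {mpoly K[3]}).
Local Notation Y := ('X_i1 : {mpoly K[3]}).
Local Notation Z := ('X_i2 : {mpoly K[3]}).

(** The derivative of the cubic at R in the direction of the variable point:
    its zero set is the tangent at R. *)
Definition polarR : {mpoly K[3]} :=
  (- 3 * x0 ^+ 2 - a) *: X + (2 * y0) *: Y
  + (y0 ^+ 2 - 2 * a * x0 - 3 * b) *: Z.

(** The derivative of the cubic at the variable point in the direction of R. *)
Definition polarR2 : {mpoly K[3]} :=
  (2 * y0) *: (Y * Z) + Y * Y - (3 * x0) *: (X * X)
  - a *: (x0 *: (Z * Z) + 2 *: (X * Z)) - (3 * b) *: (Z * Z).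

(** On the line PR the cubic takes at s P + t R the value s t (s a + t b),
    where a and b are the values at P of [polarR2] and [polarR], when P and R
    are on the curve; so b P - a R is the third intersection point. These
    forms vanish together on the curve exactly at R. *)
Definition secant_forms (i : 'I_3) : {mpoly K[3]} :=
  polarR * 'X_i - R 0 i *: polarR2.

(** The slope (y - y0) / (x - x0) of the line PR equals
    (x^2 + x0 x + x0^2 + a) / (y + y0) on the curve. The second fraction makes
    sense at R, where it is the slope of the tangent; [slopeN] and [slopeD]
    are its numerator and denominator, made homogeneous. *)
Definition slopeN : {mpoly K[3]} :=
    X * X + x0 *: (X * Z) + (x0 ^+ 2 + a) *: (Z * Z).
Definition slopeD : {mpoly K[3]} := (Y + y0 *: Z) * Z.

(** With n / d the slope of the line PR, its third intersection point has
    abscissa (n / d)^2 - x - x0; here the slope is written with [slopeN] and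
    [slopeD], so that the expression is valid near R. *)
Definition tangent_forms (i : 'I_3) : {mpoly K[3]} :=
  [:: (slopeN * slopeN - (X + x0 *: Z) * Z * ((Y + y0 *: Z) * (Y + y0 *: Z)))
      * slopeD;
      y0 *: (slopeD * slopeD * slopeD) + slopeN * (slopeN * slopeN
        - (X + (2 * x0) *: Z) * Z * ((Y + y0 *: Z) * (Y + y0 *: Z)));
      slopeD * slopeD * slopeD]`_i.

Let homM d e (F G : {mpoly K[3]}) :
  F \is d.-homog -> G \is e.-homog -> F * G \is (d + e).-homog.
Proof. exact: dhomogM. Qed.

Lemma secant_forms_homog i : secant_forms i \is 2.-homog.
Proof.
have hX := @homog_X K.
apply: rpredB; first apply: (@homM 1 1) => //.
  by rewrite /polarR; do ![apply: rpredD | apply: rpredZ]; exact: hX.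
apply: rpredZ; rewrite /polarR2;
    do ![apply: rpredB | apply: rpredD | apply: rpredZ];
  exact: (@homM 1 1).
Qed.

Lemma tangent_forms_homog i : tangent_forms i \is 6.-homog.
Proof.
have hX := @homog_X K.
have hlin (c : K) j : 'X_j + c *: Z \is 1.-homog by rewrite rpredD ?rpredZ.
have hN : slopeN \is 2.-homog.
  by rewrite /slopeN; do ![apply: rpredD | apply: rpredZ]; exact: (@homM 1 1).
have hD : slopeD \is 2.-homog by apply: (@homM 1 1).
have hNN c : slopeN * slopeN - (X + c *: Z) * Z * ((Y + y0 *: Z) * (Y + y0 *:
    Z))
    \is 4.-homog.
  by apply: rpredB; apply: (@homM 2 2) => //; exact: (@homM 1 1).
have hDDD : slopeD * slopeD * slopeD \is 6.-homog.
  by apply: (@homM 4 2) => //; exact: (@homM 2 2).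
move: i; apply: ord3P; rewrite /tangent_forms /=.
- exact: (@homM 4 2).
- by rewrite rpredD ?rpredZ //; exact: (@homM 2 4).
exact: hDDD.
Qed.

Definition secant (P : 'rV[K]_3) : 'rV[K]_3 := \row_i ev (secant_forms i) P.
Definition tangential (P : 'rV[K]_3) : 'rV[K]_3 :=
    \row_i ev (tangent_forms i) P.

Definition third_point P := if secant P == 0 then tangential P else secant P.

Lemma secantZ c P : secant (c *: P) = c ^+ 2 *: secant P.
Proof. exact: row_evZ secant_forms_homog. Qed.

Lemma tangentialZ c P : tangential (c *: P) = c ^+ 6 *: tangential P.
Proof. exact: row_evZ tangent_forms_homog. Qed.

Let pb x y z := (- 3 * x0 ^+ 2 - a) * x + 2 * y0 * y
   + (y0 ^+ 2 - 2 * a * x0 - 3 * b) * z.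
Let pa x y z := 2 * y0 * y * z + y ^+ 2 - 3 * x0 * x ^+ 2
   - a * (x0 * z ^+ 2 + 2 * x * z) - 3 * b * z ^+ 2.

Lemma secantE x y z : secant (vec3 x y z) =
  vec3 (pb x y z * x - pa x y z * x0) (pb x y z * y - pa x y z * y0)
       (pb x y z * z - pa x y z).
Proof.
by apply: row3P; rewrite mxE !vec3E !evE /R !vec3E /pb /pa; ring.
Qed.

Lemma tangentialE x y z : tangential (vec3 x y z) =
  let n := x ^+ 2 + x0 * x * z + (x0 ^+ 2 + a) * z ^+ 2 in
  let e := y + y0 * z in
  vec3 ((n ^+ 2 - (x + x0 * z) * z * e ^+ 2) * (e * z))
       (y0 * (e * z) ^+ 3 + n * (n ^+ 2 - (x + 2 * x0 * z) * z * e ^+ 2))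
       ((e * z) ^+ 3).
Proof.
by apply: row3P; rewrite mxE !vec3E /tangent_forms /= !evE !vec3E; ring.
Qed.

Let n0 := 3 * x0 ^+ 2 + a.
Let d0 := 2 * y0.
Let T0 := vec3 ((n0 ^+ 2 - 2 * x0 * d0 ^+ 2) * d0)
  (y0 * d0 ^+ 3 + n0 * (n0 ^+ 2 - 3 * x0 * d0 ^+ 2)) (d0 ^+ 3).

Lemma tangential_R c : tangential (c *: R) = c ^+ 6 *: T0.
Proof.
rewrite (vec3_eta (c *: R)) !mxE /= tangentialE /=.
by apply: row3P; rewrite !mxE /= /n0 /d0; ring.
Qed.

(** Both terms vanish only if R is a singular point. *)
Lemma tangent_slope_defined : (n0 != 0) || (d0 != 0).
Proof.
apply: contraNT disc_neq0; rewrite negb_or !negbK => /andP[/eqP en /eqP ed].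
have ey : y0 = 0 by apply: (mulfI (_ : 2 != 0)); rewrite ?pnatr_eq0 // mulr0.
have ea : a = - 3 * x0 ^+ 2 by rewrite -[RHS]addr0 -en /n0; ring.
by rewrite /disc /b ey ea; apply/eqP; ring.
Qed.

Lemma tangential_R_neq0 : T0 != 0.
Proof.
rewrite vec3_eq0 !negb_and expf_eq0 /=.
have [ed | _] := eqVneq d0 0; last by rewrite !orbT.
have := tangent_slope_defined; rewrite ed eqxx orbF => nz_n.
rewrite orbF; apply/orP; right.
by rewrite [X in X != 0](_ : _ = n0 ^+ 3) ?expf_neq0 //; ring.
Qed.

Lemma secant_R c : secant (c *: R) = 0.
Proof.
rewrite (vec3_eta (c *: R)) !mxE /= secantE.
by apply/eqP; rewrite vec3_eq0 /pb /pa /b; apply/and3P; split; apply/eqP; ring.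
Qed.

(** If b P = a R with a and b not both zero, P is proportional to R. If a and
    b both vanish, z a - z^2 b = (x - x0 z)^3 on the curve gives x = x0 z, and
    then y = y0 z. *)
Lemma secant_eq0_proportional P : on_curve E P -> secant P = 0 ->
    exists2 c, c != 0 & P = c *: R.
Proof.
rewrite (vec3_eta P); move: (P 0 i0) (P 0 i1) (P 0 i2) => x y z EP.
rewrite secantE => /eqP; rewrite vec3_eq0 => /and3P[/eqP e1 /eqP e2 /eqP e3].
suff PR : exists c, vec3 x y z = c *: R.
  case: PR => c PR; exists c => //; apply: contraTneq EP.1 => c0.
  by rewrite PR c0 scale0r eqxx.
have [pb0 | nz_b] := eqVneq (pb x y z) 0; last first.
  exists (pa x y z / pb x y z); apply: row3P; rewrite !mxE /=.
  - by apply: (mulfI nz_b); apply/eqP; rewrite -subr_eq0 -e1; apply/eqP; field.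
  - by apply: (mulfI nz_b); apply/eqP; rewrite -subr_eq0 -e2; apply/eqP; field.
  by apply: (mulfI nz_b); apply/eqP; rewrite -subr_eq0 -e3; apply/eqP; field.
(* The remaining case: the cubic vanishes identically on the line PR. *)
have pa0 : pa x y z = 0.
  by apply/eqP; rewrite -oppr_eq0 -e3 pb0; apply/eqP; ring.
have EP0 := on_weierE EP.
have /eqP : (x - x0 * z) ^+ 3 = 0.
  have -> : (x - x0 * z) ^+ 3 = pa x y z * z - pb x y z * z ^+ 2
    - (y ^+ 2 * z - x ^+ 3 - a * x * z ^+ 2 - b * z ^+ 3).
    by rewrite /pa /pb /b; ring.
  by rewrite pa0 pb0 EP0; ring.
rewrite expf_eq0 /= => /eqP xi0.
have [z0 | nz_z] := eqVneq z 0.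
  move: EP pa0; rewrite z0 => /on_weier_infty[-> /negP nz_y] pa0.
  case: nz_y; rewrite -sqrf_eq0 -pa0 /pa; apply/eqP; ring.
have eta0 : y - y0 * z = 0.
  apply/eqP; rewrite -sqrf_eq0 -(mulrI_eq0 _ (mulfI nz_z)).
  have -> : z * (y - y0 * z) ^+ 2 = (x - x0 * z) ^+ 2 * (x + 2 * x0 * z)
    - pb x y z * z ^+ 2
    + (y ^+ 2 * z - x ^+ 3 - a * x * z ^+ 2 - b * z ^+ 3).
    by rewrite /pb /b; ring.
  by rewrite xi0 pb0 EP0; apply/eqP; ring.
exists z; apply: row3P; rewrite !mxE /= ?mulr1 //.
  by apply/eqP; rewrite -subr_eq0 mulrC xi0.
by apply/eqP; rewrite -subr_eq0 mulrC eta0.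
Qed.

Lemma secant_on_curve P : on_curve E P -> secant P != 0 ->
    on_curve E (secant P).
Proof.
move=> EP nzT; split=> //; move: EP.
rewrite (vec3_eta P); move: (P 0 i0) (P 0 i1) (P 0 i2) => x y z EP.
rewrite secantE ev_weier3 -[RHS](mulr0 (pb x y z ^+ 3)) -(on_weierE EP).
by rewrite /pa /pb /b; ring.
Qed.

Lemma tangential_R_on_curve : on_curve E T0.
Proof.
by split; [exact: tangential_R_neq0 | rewrite ev_weier3 /n0 /d0 /b; ring].
Qed.

(** Formal consequence of the definition by polars: if Q = b P - a R, then the
    polars of Q are b^2 and - a b^2. *)
Lemma secantK P : secant (secant P) = ev polarR P ^+ 3 *: P.
Proof.
rewrite (vec3_eta P); move: (P 0 i0) (P 0 i1) (P 0 i2) => x y z.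
have -> : ev polarR (vec3 x y z) = pb x y z by rewrite !evE !vec3E.
rewrite !secantE.
by apply: row3P; rewrite !mxE /= /pb /pa /b; ring.
Qed.

Let V n d x := vec3 ((n ^+ 2 - (x + x0) * d ^+ 2) * d)
  (y0 * d ^+ 3 + n * (n ^+ 2 - (x + 2 * x0) * d ^+ 2)) (d ^+ 3).

Let VZ c n d x : V (c * n) (c * d) x = c ^+ 3 *: V n d x.
Proof. by apply: row3P; rewrite !mxE /=; ring. Qed.

Let V_eq0 x : V 0 0 x = 0.
Proof. by apply/eqP; rewrite vec3_eq0; apply/and3P; split; apply/eqP; ring. Qed.

(** In affine coordinates both points are given by the same cubic expression V
    in a numerator and a denominator of the slope, and the two fractions agree
    on the curve. *)
Lemma secant_tangential P : on_curve E P -> secant P != 0 ->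
  tangential P != 0 -> proportional (secant P) (tangential P).
Proof.
rewrite (vec3_eta P); move: (P 0 i0) (P 0 i1) (P 0 i2) => x' y' z EP.
have [z0 | nz_z] := eqVneq z 0.
  move: EP; rewrite z0 => /on_weier_infty[-> _] _ /eqP[].
  rewrite tangentialE /=; apply/eqP.
  by rewrite vec3_eq0; apply/and3P; split; apply/eqP; ring.
have scaleP : vec3 x' y' z = z *: vec3 (x' / z) (y' / z) 1.
  by apply: row3P; rewrite !mxE /=; field.
move: (x' / z) (y' / z) scaleP EP => x y -> EP.
have EP1 : y ^+ 2 * 1 - x ^+ 3 - a * x * 1 ^+ 2 - b * 1 ^+ 3 = 0.
  apply: on_weierE; apply: (on_curve_proportional (weier_homog a b)) EP.
  exact/proportional_sym/proportionalZ.
have sE : secant (vec3 x y 1) = - 1 *: V (y - y0) (x - x0) x.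
  rewrite -[RHS]addr0 -(scale0r (vec3 (x - 2 * x0) (y - 2 * y0) (- 1))) -EP1
      secantE.
  by apply: row3P; rewrite !mxE /= /pa /pb /b; ring.
pose n := x ^+ 2 + x0 * x + x0 ^+ 2 + a; pose d := y + y0.
have tE : tangential (vec3 x y 1) = V n d x.
  by rewrite tangentialE; apply: row3P; rewrite !mxE /= /n /d; ring.
have slopes : (y - y0) * d = (x - x0) * n.
  by apply/eqP; rewrite -subr_eq0 -EP1 /n /d /b; apply/eqP; ring.
rewrite secantZ tangentialZ sE tE scalerA.
rewrite !scaler_eq0 !negb_or => /andP[_ nzs] /andP[_ nzt].
have [k nz_k [en ed]] : exists2 k, k != 0 & n = k * (y - y0) /\ d =
    k * (x - x0).
  have [xi0 | nz_xi] := eqVneq (x - x0) 0; last first.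
    have en : n = d / (x - x0) * (y - y0).
      by apply: (mulfI nz_xi); rewrite -slopes; field.
    exists (d / (x - x0)); last by rewrite divfK.
    apply: contraNneq nzt => k0; move: en; rewrite k0 mul0r => ->.
    move/eqP: k0; rewrite mulf_eq0 invr_eq0 (negPf nz_xi) orbF => /eqP->.
    by rewrite V_eq0.
  have nz_eta : y - y0 != 0 by apply: contraNneq nzs => ->; rewrite xi0 V_eq0.
  have d_0 : d = 0 by apply: (mulfI nz_eta); rewrite slopes xi0 mul0r mulr0.
  exists (n / (y - y0)); last by rewrite divfK // xi0 mulr0.
  rewrite mulf_neq0 ?invr_eq0 //; apply: contraNneq nzt => ->.
  by rewrite d_0 V_eq0.
apply: proportional_sym; exists (z ^+ 6 * k ^+ 3 / (z ^+ 2 * -1)).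
  by rewrite !mulf_neq0 ?invr_eq0 ?mulf_neq0 ?expf_neq0 ?oppr_eq0 ?oner_eq0.
rewrite en ed VZ !scalerA; congr (_ *: _); field.
by rewrite ?nz_z ?oppr_eq0 ?oner_eq0.
Qed.

Lemma third_point_secant P : secant P != 0 -> third_point P = secant P.
Proof. by rewrite /third_point => /negPf->. Qed.

Lemma third_point_R c : third_point (c *: R) = c ^+ 6 *: T0.
Proof. by rewrite /third_point secant_R eqxx tangential_R. Qed.

(** The secant forms give a local expression near every point other than R,
    and the tangent forms near R. *)
Lemma third_point_morphism : curve_morphism E E third_point.
Proof.
have hom_s := secant_forms_homog; have hom_t := tangent_forms_homog.
have nz_coord (P : 'rV[K]_3) : P != 0 -> exists i, P 0 i != 0.
  move=> nzP; apply/existsP; apply: contraNT nzP => /existsPn P0.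
  by apply/eqP/rowP => i; rewrite mxE; apply/eqP/negPn/P0.
split=> P EP.
  have [s0 | nz_s] := eqVneq (secant P) 0; last first.
    by rewrite third_point_secant //; exact: secant_on_curve.
  have [c nz_c ->] := secant_eq0_proportional EP s0; rewrite third_point_R.
  apply: (on_curve_proportional (weier_homog a b)) tangential_R_on_curve.
  by apply: proportionalZ; rewrite expf_neq0.
have [s0 | nz_s] := eqVneq (secant P) 0; last first.
  have [i nz_i] := nz_coord _ nz_s.
  exists 2%N, 2%N, (DHomog (hom_s i)), (fun j => DHomog (hom_s j)).
  split=> [|Q EQ hQ]; first by move: nz_i; rewrite mxE.
  rewrite third_point_secant; first exact: proportional_refl.
  by apply: contraNneq hQ => /rowP/(_ i); rewrite !mxE => /= ->.
have nz_t : tangential P != 0.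
  have [c nz_c ->] := secant_eq0_proportional EP s0.
  by rewrite tangential_R scaler_eq0 negb_or expf_neq0 //= tangential_R_neq0.
have [i nz_i] := nz_coord _ nz_t.
exists 6%N, 6%N, (DHomog (hom_t i)), (fun j => DHomog (hom_t j)).
split=> [|Q EQ hQ]; first by move: nz_i; rewrite mxE.
have nz_tQ : tangential Q != 0.
  by apply: contraNneq hQ => /rowP/(_ i); rewrite !mxE => /= ->.
have [sQ0 | nz_sQ] := eqVneq (secant Q) 0.
  by rewrite /third_point sQ0 eqxx; exact: proportional_refl.
by rewrite third_point_secant //; exact: secant_tangential.
Qed.

(** The three points P, R and the image of P are collinear, and the roles of P
    and its image are symmetric. Away from R this is [secantK]; the two
    remaining cases are P = R, and P on the tangent at R. *)
Lemma third_pointK P : on_curve E P ->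
    proportional (third_point (third_point P)) P.
Proof.
move=> EP; have [s0 | nz_s] := eqVneq (secant P) 0.
  have [c nz_c ->] := secant_eq0_proportional EP s0; rewrite third_point_R.
  apply: (@proportional_trans _ _ _ R);
      last exact/proportional_sym/proportionalZ.
  have c6 : c ^+ 6 != 0 by rewrite expf_neq0.
  have [sT0 | nz_sT] := eqVneq (secant T0) 0.
    have [k nz_k TR] := secant_eq0_proportional tangential_R_on_curve sT0.
    rewrite TR scalerA third_point_R TR scalerA.
    by apply: proportionalZ; rewrite mulf_neq0 ?expf_neq0 ?mulf_neq0.
  rewrite third_point_secant secantZ;
      last by rewrite scaler_eq0 negb_or expf_neq0.
  apply: proportional_trans (proportionalZ _ _) _; first by rewrite expf_neq0.
  move: nz_sT; rewrite secantE.
  have -> : pb ((n0 ^+ 2 - 2 * x0 * d0 ^+ 2) * d0)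
     (y0 * d0 ^+ 3 + n0 * (n0 ^+ 2 - 3 * x0 * d0 ^+ 2)) (d0 ^+ 3) = 0.
    by rewrite /pb /n0 /d0 /b; ring.
  move: (pa _ _ _) => k; rewrite !mul0r !sub0r => nz_k.
  have kR : vec3 (- (k * x0)) (- (k * y0)) (- k) = - k *: R.
    by apply: row3P; rewrite !mxE /=; ring.
  exists (- k) => //; apply: contraNneq nz_k => k0.
  by rewrite kR k0 scale0r.
rewrite (third_point_secant nz_s).
have [ss0 | nz_ss] := eqVneq (secant (secant P)) 0; last first.
  rewrite third_point_secant // secantK; apply: proportionalZ.
  by apply: contraNneq nz_ss; rewrite secantK => ->; rewrite scale0r.
have [k nz_k sR] := secant_eq0_proportional (secant_on_curve EP nz_s) ss0.
rewrite sR third_point_R; apply: proportional_trans (proportionalZ _ _) _.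
  by rewrite expf_neq0.
have nz_sP : P != 0 by case: EP.
have pb0 : ev polarR P = 0.
  move: ss0 => /eqP; rewrite secantK scaler_eq0 (negPf nz_sP) orbF expf_eq0 /=.
  by move/eqP.
move: pb0 EP nz_s; rewrite (vec3_eta P).
move: (P 0 i0) (P 0 i1) (P 0 i2) => x y z pb0 EP nz_s.
have {}pb0 : pb x y z = 0 by rewrite -pb0 !evE !vec3E.
have EP0 := on_weierE EP.
have notR : vec3 x y z != z *: R by apply: contraNneq nz_s => ->;
    rewrite secant_R.
have line : d0 * (y - y0 * z) = n0 * (x - x0 * z).
  by apply/eqP; rewrite -subr_eq0 -pb0 /pb /n0 /d0 /b; apply/eqP; ring.
have [z0 | nz_z] := eqVneq z 0.
  move: EP line; rewrite z0 => /on_weier_infty[-> nz_y].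
  rewrite !mulr0 !subr0 mulr0 => /eqP; rewrite mulf_eq0 (negPf nz_y) orbF.
  move=> /eqP d_0; have nz_n : n0 != 0 by have := tangent_slope_defined;
      rewrite d_0 eqxx orbF.
  exists (n0 ^+ 3 / y); first by rewrite mulf_neq0 ?expf_neq0 ?invr_eq0.
  by apply: row3P; rewrite !mxE /= d_0; field.
have xi_eta : z * (y - y0 * z) ^+ 2 = (x - x0 * z) ^+ 2 * (x + 2 * x0 * z).
  apply/eqP; rewrite -subr_eq0; apply/eqP.
  transitivity (- pb x y z * z ^+ 2
    + (y ^+ 2 * z - x ^+ 3 - a * x * z ^+ 2 - b * z ^+ 3)).
    by rewrite /pb /b; ring.
  by rewrite pb0 EP0; ring.
have [xi0 | nz_xi] := eqVneq (x - x0 * z) 0.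
  have eta0 : y - y0 * z = 0.
    apply/eqP; rewrite -sqrf_eq0 -(mulrI_eq0 _ (mulfI nz_z)) xi_eta xi0.
    by apply/eqP; ring.
  case/negP: notR; apply/eqP; apply: row3P; rewrite !mxE /= ?mulr1 //.
    by apply/eqP; rewrite -subr_eq0 mulrC xi0.
  by apply/eqP; rewrite -subr_eq0 mulrC eta0.
have nz_d : d0 != 0.
  apply: contraNneq nz_xi => d_0.
  have nz_n : n0 != 0 by have := tangent_slope_defined; rewrite d_0 eqxx orbF.
  by rewrite -(mulrI_eq0 _ (mulfI nz_n)) -line d_0 mul0r.
exists (d0 ^+ 3 / z); first by rewrite mulf_neq0 ?expf_neq0 ?invr_eq0.
have ey : y = y0 * z + n0 * (x - x0 * z) / d0.
  by apply: (mulfI nz_d); rewrite mulrDr [RHS]addrC mulrCA divff // mulr1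
      -line; ring.
have ex : x = z * (n0 ^+ 2 / d0 ^+ 2 - 2 * x0).
  have : z * (n0 / d0) ^+ 2 = x + 2 * x0 * z.
    apply: (mulfI (expf_neq0 2 nz_xi)); rewrite -xi_eta {1}ey; field.
    exact: nz_d.
  by move=> e; apply: (addIr (2 * x0 * z)); rewrite -e; field.
apply: row3P; rewrite !mxE /= ?ey ?ex; field; by rewrite ?nz_z ?nz_d.
Qed.

(** The line through R and its reflection in the axis y = 0 is vertical, and
    meets the curve at infinity. *)
Lemma third_point_opposite : proportional (third_point (vec3 x0 (- y0) 1))
    (vec3 0 1 0).
Proof.
have [s0 | nz_s] := eqVneq (secant (vec3 x0 (- y0) 1)) 0.
  have EQ : on_curve E (vec3 x0 (- y0) 1).
    split; first by rewrite vec3_eq0 oner_eq0 !andbF.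
    by rewrite ev_weier3 /b; ring.
  have [c nz_c QR] := secant_eq0_proportional EQ s0; rewrite QR third_point_R.
  have c1 : c = 1 by have := congr1 (fun P : 'rV_3 => P 0 i2) QR;
      rewrite !mxE /= mulr1.
  have d_0 : d0 = 0.
    have := congr1 (fun P : 'rV_3 => P 0 i1) QR; rewrite !mxE /= c1 mul1r /d0.
    by move/eqP; rewrite eq_sym -subr_eq0 opprK => /eqP <-; ring.
  have nz_n : n0 != 0 by have := tangent_slope_defined; rewrite d_0 eqxx orbF.
  exists (n0 ^+ 3); first by rewrite expf_neq0.
  by apply: row3P; rewrite !mxE /= d_0 c1; ring.
rewrite third_point_secant //; move: nz_s; rewrite secantE.
set y := _ - pa _ _ _ * y0.
have -> : pb x0 (- y0) 1 * x0 - pa x0 (- y0) 1 * x0 = 0 by rewrite /pa /pb /b;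
    ring.
have -> : pb x0 (- y0) 1 * 1 - pa x0 (- y0) 1 = 0 by rewrite /pa /pb /b; ring.
rewrite vec3_eq0 eqxx /= andbT => nz_y; exists y => //.
by apply: row3P; rewrite !mxE /= ?mulr0 ?mulr1.
Qed.

End ThirdPoint.

Section SwapPoint.
Variable K : numClosedFieldType.

(** The involution [third_point] centred at the reflection of P in the axis
    y = 0 exchanges P with the point at infinity. *)
Lemma weier_move_point (a b : K) P : disc a b != 0 -> on_curve (weier a b) P ->
  exists phi psi, [/\ curve_morphism (weier a b) (weier a b) phi,
    curve_morphism (weier a b) (weier a b) psi,
    forall Q, on_curve (weier a b) Q -> proportional (psi (phi Q)) Q,
    forall Q, on_curve (weier a b) Q -> proportional (phi (psi Q)) Q
    & proportional (phi P) (vec3 0 1 0)].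
Proof.
rewrite (vec3_eta P); move: (P 0 i0) (P 0 i1) (P 0 i2) => x y z nz_disc EP.
have [z0 | nz_z] := eqVneq z 0.
  have id_morphism : curve_morphism (weier a b) (weier a b) (mulmxr 1%:M).
    by apply: curve_morphism_mulmx => Q; rewrite mulmx1.
  exists (mulmxr 1%:M), (mulmxr 1%:M).
  split=> // [Q _|Q _|] /=; rewrite !mulmx1; try exact: proportional_refl.
  move: EP; rewrite z0 => /on_weier_infty[-> nz_y]; exists y => //.
  by apply: row3P; rewrite !mxE /= ?mulr0 ?mulr1.
pose x0 := x / z; pose y0 := - y / z.
have eb : b = y0 ^+ 2 - x0 ^+ 3 - a * x0.
  case: EP => _; rewrite ev_weier3 => EP0.
  apply: (mulfI (expf_neq0 3 nz_z)).
  apply/eqP; rewrite -subr_eq0 -oppr_eq0 -EP0 /x0 /y0; apply/eqP; field.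
  exact: nz_z.
have swapP : vec3 x y z = z *: vec3 x0 (- y0) 1.
  by apply: row3P; rewrite !mxE /= /x0 /y0; field.
rewrite eb in nz_disc EP *.
have Mtau := third_point_morphism nz_disc.
exists (third_point a x0 y0), (third_point a x0 y0); split=> //.
- exact: third_pointK.
- exact: third_pointK.
apply: proportional_trans (third_point_opposite nz_disc).
apply: (curve_morphism_proportional Mtau EP); last by rewrite swapP;
    exact: proportionalZ.
apply: (on_curve_proportional (weier_homog a _)) EP.
by rewrite swapP; apply/proportional_sym/proportionalZ.
Qed.

End SwapPoint.

(** * The coordinate ring of the affine curve *)

Section AffineRing.
Variable K : numClosedFieldType.
Variables a b : K.
Implicit Types (A B p : {poly K}) (u v w : {poly K} * {poly K}) (x y : K).

Definition affine x y : Prop := y ^+ 2 = x ^+ 3 + a * x + b.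

Lemma affineP x y : affine x y <-> on_curve (weier a b) (vec3 x y 1).
Proof.
split=> [e | /on_weierE e].
  split; first by rewrite vec3_eq0 oner_eq0 !andbF.
  by rewrite ev_weier3 !expr1n !mulr1 e; ring.
by apply/eqP; rewrite -subr_eq0 -e; apply/eqP; ring.
Qed.

Lemma affine_opp x y : affine x y -> affine x (- y).
Proof. by rewrite /affine sqrrN. Qed.

Lemma affine_ex x : exists y, affine x y.
Proof. by exists (sqrtC (x ^+ 3 + a * x + b)); rewrite /affine sqrtCK. Qed.

(** Locked, so that evaluation rules do not expand it. *)
Definition cubic : {poly K} := locked (poly3 b a 0 1).

Lemma cubicE : cubic = poly3 b a 0 1. Proof. by rewrite /cubic -lock. Qed.

Lemma horner_cubic x y : affine x y -> cubic.[x] = y ^+ 2.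
Proof. by move=> ->; rewrite cubicE horner_poly3; ring. Qed.

Lemma size_cubic : size cubic = 4%N.
Proof.
rewrite cubicE; apply/eqP; rewrite eqn_leq; apply/andP; split.
  by apply/leq_sizeP => -[|[|[|[|j]]]] // _; rewrite coef_poly3 /= nth_nil.
by rewrite ltnNge; apply/negP => /leq_sizeP/(_ 3%N isT)/eqP;
    rewrite coef_poly3 oner_eq0.
Qed.

Lemma cubic_neq0 : cubic != 0.
Proof. by rewrite -size_poly_eq0 size_cubic. Qed.

(** A pair (A, B) stands for the function A(x) + B(x) y on the affine curve.
    By [aff_val_eq] such a function determines the pair. *)
Definition aff_val u x y : K := u.1.[x] + u.2.[x] * y.

Definition aff_mul u v : {poly K} * {poly K} :=
  (u.1 * v.1 + u.2 * v.2 * cubic, u.1 * v.2 + u.2 * v.1).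

Definition aff_add u v : {poly K} * {poly K} := (u.1 + v.1, u.2 + v.2).

Definition aff_const (c : K) : {poly K} * {poly K} := (c%:P, 0).

(** The product of A + B y with its conjugate A - B y. *)
Definition aff_norm u : {poly K} := u.1 ^+ 2 - u.2 ^+ 2 * cubic.

Lemma aff_val_mul u v x y : affine x y ->
    aff_val (aff_mul u v) x y = aff_val u x y * aff_val v x y.
Proof.
by move=> /horner_cubic e; rewrite /aff_val /= !hornerE e; ring.
Qed.

Lemma aff_val_add u v x y : aff_val (aff_add u v) x y =
    aff_val u x y + aff_val v x y.
Proof. by rewrite /aff_val /= !hornerD; ring. Qed.

Lemma aff_val_const c x y : aff_val (aff_const c) x y = c.
Proof. by rewrite /aff_val /= hornerC horner0 mul0r addr0. Qed.

Lemma aff_norm_val u x y : affine x y ->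
  (aff_norm u).[x] = aff_val u x y * aff_val u x (- y).
Proof. by move=> /horner_cubic e; rewrite /aff_norm /aff_val !hornerE e;
    ring. Qed.

Lemma aff_norm_mul u v : aff_norm (aff_mul u v) = aff_norm u * aff_norm v.
Proof. by rewrite /aff_norm /=; ring. Qed.

(** The values at (x, y) and (x, -y) determine A(x), and B(x) unless y = 0. *)
Lemma aff_val_eq u v : (forall x y, affine x y ->
    aff_val u x y = aff_val v x y) -> u = v.
Proof.
move=> e; have e1 : u.1 = v.1.
  apply: poly_ext => x; have [y xy] := affine_ex x.
  apply: (mulfI (_ : 2 != 0)); first by rewrite pnatr_eq0.
  transitivity (aff_val u x y + aff_val u x (- y)); first by rewrite /aff_val;
      ring.
  rewrite (e x y xy) (e x (- y)) /aff_val; last exact: affine_opp.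
  by ring.
rewrite [u]surjective_pairing [v]surjective_pairing e1; congr (_, _).
apply: (mulIf cubic_neq0); apply: poly_ext => x; have [y xy] := affine_ex x.
have := e x y xy; rewrite /aff_val e1 => /addrI e2.
by rewrite !hornerM (horner_cubic xy) expr2 !mulrA e2.
Qed.

Lemma size_sqr p : size (p ^+ 2) = (size p).*2.-1.
Proof.
have [-> | nz_p] := eqVneq p 0; first by rewrite expr0n /= size_poly0.
by rewrite expr2 size_mul // addnn.
Qed.

Lemma size_sqr_cubic p :
  size (p ^+ 2 * cubic) = if p == 0 then 0%N else (size p).*2.+2.
Proof.
case: eqVneq => [-> | nz_p]; first by rewrite expr0n mul0r size_poly0.
rewrite size_mul ?expf_neq0 ?cubic_neq0 // size_cubic size_sqr.
by rewrite -(prednK (_ : 0 < size p)%N) ?size_poly_gt0 // doubleS !addnS addn0.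
Qed.

(** The terms A^2 and B^2 (x^3 + a x + b) have degrees of different parities,
    so their leading terms do not cancel. *)
Lemma size_aff_norm u :
  size (aff_norm u) = maxn (size u.1).*2.-1 (if u.2 == 0 then 0%N else (size
      u.2).*2.+2).
Proof.
rewrite /aff_norm -size_sqr -size_sqr_cubic.
case: (ltngtP (size (u.1 ^+ 2)) (size (u.2 ^+ 2 * cubic))) => [lt | lt | eq].
- by rewrite addrC size_polyDl ?size_polyN.
- by rewrite size_polyDl ?size_polyN.
move: (eq); rewrite size_sqr size_sqr_cubic.
case: (eqVneq u.2 0) => [u2_0 | _].
  move=> /= e; have: size u.1 == 0%N by case: (size u.1) e.
  rewrite size_poly_eq0 => /eqP u1_0.
  by rewrite u1_0 u2_0 !expr0n !mul0r subr0 size_poly0.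
case: (size u.1) => [|n] //; rewrite doubleS /= => /(congr1 odd).
by rewrite /= !odd_double.
Qed.

Lemma aff_norm_eq0 u : aff_norm u = 0 -> u = (0, 0).
Proof.
move/eqP; rewrite -size_poly_eq0 size_aff_norm -leqn0 geq_max !leqn0 => /andP[].
rewrite [u]surjective_pairing /=.
case: (eqVneq u.2 0) => // -> e _; congr (_, _); apply/eqP.
by rewrite -size_poly_eq0; case: (size u.1) e.
Qed.

Lemma size_aff_norm_add_le u v n : (size (aff_norm u) <= n)%N ->
  (size (aff_norm v) <= n)%N -> (size (aff_norm (aff_add u v)) <= n)%N.
Proof.
have size_add (p q : {poly K}) : (size (p + q)%R <= size p)%N \/ (size (p +
    q)%R <= size q)%N.
  by have := size_polyD p q; rewrite leq_max => /orP.
rewrite !size_aff_norm !geq_max /= => /andP[u1 u2] /andP[v1 v2].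
apply/andP; split.
  case: (size_add u.1 v.1) => h.
    by apply: leq_trans u1; rewrite -!subn1 leq_sub2r // leq_double.
  by apply: leq_trans v1; rewrite -!subn1 leq_sub2r // leq_double.
case: (eqVneq u.2 0) u2 => [-> _ | nz_u u2]; first by rewrite add0r.
case: (eqVneq v.2 0) v2 => [-> _ | nz_v v2];
    first by rewrite addr0 (negPf nz_u).
case: eqVneq => // _; case: (size_add u.2 v.2) => h.
  by apply: leq_trans u2; rewrite !ltnS leq_double.
by apply: leq_trans v2; rewrite !ltnS leq_double.
Qed.

Lemma size_aff_norm_opp u : size (aff_norm (- u.1, - u.2)) = size (aff_norm u).
Proof. by rewrite !size_aff_norm /= oppr_eq0 !size_polyN. Qed.

Lemma size_aff_norm_add u v : (size (aff_norm u) < size (aff_norm v))%N ->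
  size (aff_norm (aff_add u v)) = size (aff_norm v).
Proof.
move=> lt_uv; apply/eqP; rewrite eqn_leq size_aff_norm_add_le //=;
    last exact: ltnW.
rewrite leqNgt; apply/negP => lt_s.
have : (size (aff_norm v) <= (size (aff_norm v)).-1)%N.
  have {1}-> : v = aff_add (- u.1, - u.2) (aff_add u v).
    by rewrite [LHS]surjective_pairing /aff_add /=; congr (_, _); ring.
  apply: size_aff_norm_add_le; last by rewrite -ltnS (ltn_predK lt_uv).
  by rewrite size_aff_norm_opp -ltnS (ltn_predK lt_uv).
by rewrite -ltnS (ltn_predK lt_uv) ltnn.
Qed.

(** The order of the pole of A(x) + B(x) y at infinity: x has order 2 and y
    has order 3. *)
Definition aff_ord u := (size (aff_norm u)).-1.

Lemma aff_norm_neq0 u : u != (0, 0) -> aff_norm u != 0.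
Proof. by apply: contraNneq => /aff_norm_eq0->. Qed.

Lemma size_aff_norm_ord u : u != (0, 0) -> size (aff_norm u) = (aff_ord u).+1.
Proof. by move=> /aff_norm_neq0; rewrite -size_poly_gt0 => /prednK. Qed.

Lemma aff_ord_mul u v : u != (0, 0) -> v != (0, 0) ->
    aff_ord (aff_mul u v) = (aff_ord u + aff_ord v)%N.
Proof.
move=> nz_u nz_v; rewrite /aff_ord aff_norm_mul size_mul ?aff_norm_neq0 //.
by rewrite !size_aff_norm_ord //= addnS.
Qed.

Lemma aff_ord_add u v : (aff_ord u < aff_ord v)%N ->
    aff_ord (aff_add u v) = aff_ord v.
Proof.
move=> lt_uv; rewrite /aff_ord size_aff_norm_add //.
have nz_v : v != (0, 0).
  by apply: contraTneq lt_uv => ->;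
      rewrite {2}/aff_ord size_aff_norm /= size_poly0 eqxx ltn0.
rewrite (size_aff_norm_ord nz_v); case: (eqVneq u (0, 0)) => [->|nz_u].
  by rewrite size_aff_norm /= size_poly0 eqxx.
by rewrite (size_aff_norm_ord nz_u).
Qed.

Lemma aff_ord_neq0 u : (0 < aff_ord u)%N -> u != (0, 0).
Proof.
by apply: contraTneq => ->; rewrite /aff_ord size_aff_norm /= size_poly0 eqxx.
Qed.

Lemma aff_ord_const c : aff_ord (aff_const c) = 0%N.
Proof. by rewrite /aff_ord size_aff_norm /= eqxx maxn0 size_polyC;
    case: eqP. Qed.

Lemma aff_addC u v : aff_add u v = aff_add v u.
Proof. by rewrite /aff_add addrC [u.2 + _]addrC. Qed.

(** The value of the polynomial p at the element u of the coordinate ring. *)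
Definition aff_comp p u : {poly K} * {poly K} :=
  foldr (fun c w => aff_add (aff_mul w u) (aff_const c)) (aff_const 0) p.

Lemma aff_val_comp p u x y : affine x y ->
    aff_val (aff_comp p u) x y = p.[aff_val u x y].
Proof.
move=> xy; rewrite /aff_comp -[p in RHS]polyseqK horner_Poly.
elim: (polyseq p) => /= [|c s IHs]; first by rewrite aff_val_const.
by rewrite aff_val_add aff_val_mul // aff_val_const IHs.
Qed.

(** The powers of u have poles of increasing orders, so the leading term of p
    dominates. *)
Lemma aff_ord_comp p u : (0 < aff_ord u)%N ->
    aff_ord (aff_comp p u) = ((size p).-1 * aff_ord u)%N.
Proof.
move=> u_gt0; have nz_u := aff_ord_neq0 u_gt0.
have [-> | nz_p] := eqVneq p 0.
  by rewrite /aff_comp polyseq0 /= aff_ord_const.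
have: last 1 p != 0 by case: p nz_p => [[|c s]] //= nz; rewrite -size_poly_eq0.
rewrite /aff_comp; elim: (polyseq p) => [|c [|d s] IHs] /=.
- by rewrite aff_ord_const.
- rewrite /aff_mul /aff_add /= !mul0r !addr0 add0r => _; exact: aff_ord_const.
move=> nz_last; have {}IHs := IHs nz_last.
set w := foldr _ _ _ in IHs.
have nz_w : w != (0, 0).
  case: s @w IHs nz_last => [|e s] w IHs /= nz_last; last first.
    by apply: aff_ord_neq0; rewrite IHs /= mulSn addn_gt0 u_gt0.
  rewrite /w /= /aff_mul /aff_add /= !mul0r !addr0 add0r xpair_eqE polyC_eq0.
  by rewrite (negPf nz_last).
rewrite aff_addC aff_ord_add aff_ord_mul // ?IHs /= ?mulSn 1?addnC //
    aff_ord_const addn_gt0.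
by rewrite u_gt0.
Qed.

End AffineRing.

(** * Regular functions on the affine curve *)

Section RegularFunctions.
Variable K : numClosedFieldType.
Variables a b : K.
Implicit Types (p d : {poly K}) (u v w : {poly K} * {poly K}) (x y : K).
Implicit Types f : K -> K -> K.

Local Notation affine := (affine a b).

Definition regular f := exists u, forall x y, affine x y ->
    f x y = aff_val u x y.

Lemma regular_ev (F : {mpoly K[3]}) : regular (fun x y => ev F (vec3 x y 1)).
Proof.
elim/mpoly_ring_ind: F => [c|i|F G [u eu] [v ev]|F G [u eu] [v ev]].
- by exists (aff_const c) => x y _; rewrite evC aff_val_const.
- move: i; apply: ord3P.
  + by exists ('X, 0) => x y _;
      rewrite evX vec3E /aff_val /= hornerX horner0 mul0r addr0.
  + by exists (0, 1) => x y _;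
      rewrite evX vec3E /aff_val /= horner0 hornerC mul1r add0r.
  by exists (aff_const 1) => x y _; rewrite evX vec3E aff_val_const.
- by exists (aff_add u v) => x y xy; rewrite evD aff_val_add eu // ev.
by exists (aff_mul a b u v) => x y xy;
    rewrite evM (aff_val_mul _ _ xy) eu // ev.
Qed.

(** The polynomials d for which d f belongs to the coordinate ring form an
    ideal of K[x]; f itself belongs to the ring when this ideal contains 1. *)
Definition denominator f d :=
  exists u, forall x y, affine x y -> d.[x] * f x y = aff_val u x y.

Lemma denominator_lin f d d' p q :
  denominator f d -> denominator f d' -> denominator f (p * d + q * d').
Proof.
case=> u eu [u' eu'].
exists (aff_add (aff_mul a b (p, 0) u) (aff_mul a b (q, 0) u')) => x y xy.
rewrite aff_val_add !(aff_val_mul _ _ xy) -eu // -eu' //.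
by rewrite /aff_val /= !(hornerD, hornerM, horner0); ring.
Qed.

(** A function that is locally a fraction of elements of the coordinate ring
    belongs to that ring. Over each x0 there are at most two points of the
    curve, and a combination of the local denominators is nonzero at both; its
    norm is a polynomial denominator in x that does not vanish at x0. As K[x]
    is principal, the ideal of denominators contains 1. *)
Lemma locally_regular f :
  (forall x0 y0, affine x0 y0 -> exists u v, aff_val v x0 y0 != 0 /\
     forall x y, affine x y -> aff_val v x y != 0 ->
         f x y * aff_val v x y = aff_val u x y) ->
  regular f.
Proof.
move=> loc_f.
have loc x0 y0 : affine x0 y0 -> exists u v, aff_val v x0 y0 != 0 /\
    forall x y, affine x y -> f x y * aff_val v x y = aff_val u x y.
  move=> xy0; have [u [v [nz_v e]]] := loc_f _ _ xy0.
  exists (aff_mul a b u v), (aff_mul a b v v) => //.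
  split=> [|x y xy]; first by rewrite (aff_val_mul _ _ xy0) mulf_neq0.
  rewrite !(aff_val_mul _ _ xy); have [-> | nz] := eqVneq (aff_val v x y) 0.
    by rewrite !mulr0.
  by rewrite mulrA e.
have den x0 : exists2 d, denominator f d & d.[x0] != 0.
  have [y0 xy0] := affine_ex a b x0; have xy0' := affine_opp xy0.
  have [u [v [nz_v e]]] := loc _ _ xy0.
  have [u' [v' [nz_v' e']]] := loc _ _ xy0'.
  have [u2 [v2 [nz nz' e2]]] : exists u2 v2, [/\ aff_val v2 x0 y0 != 0,
      aff_val v2 x0 (- y0) != 0 &
      forall x y, affine x y -> f x y * aff_val v2 x y = aff_val u2 x y].
    have [v_opp0 | nz_vopp] := eqVneq (aff_val v x0 (- y0)) 0;
        last by exists u, v.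
    have [v'_0 | nz_v'0] := eqVneq (aff_val v' x0 y0) 0; last by exists u', v'.
    exists (aff_add u u'), (aff_add v v');
        rewrite !aff_val_add v_opp0 v'_0 addr0 add0r.
    split=> // x y xy; by rewrite !aff_val_add mulrDr e // e'.
  exists (aff_norm a b v2); last by rewrite (aff_norm_val _ xy0) mulf_neq0.
  exists (aff_mul a b u2 (v2.1, - v2.2)) => x y xy.
  rewrite (aff_norm_val _ xy) (aff_val_mul _ _ xy) -e2 // /aff_val /= hornerN;
      ring.
have [d0 den_d0 nz_d0] := den 0.
have {}nz_d0 : d0 != 0 by apply: contraNneq nz_d0 => ->; rewrite horner0.
elim: (size d0) {-2}d0 (leqnn (size d0)) den_d0 nz_d0 => [|n IHn] d.
  by rewrite leqn0 size_poly_eq0 => -> .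
move=> le_dn [u eu] nz_d; have [sz1 | sz_n1] := eqVneq (size d) 1%N.
  have /size_poly1P[c nz_c dc] : size d == 1%N by rewrite sz1.
  exists (aff_mul a b (aff_const c^-1) u) => x y xy.
  by rewrite (aff_val_mul _ _ xy) aff_val_const -eu // dc hornerC mulKf.
have [x0 root_d] := closed_rootP d sz_n1.
have [d' den_d' nz_d'] := den x0.
have [[p q] /= eq_g] := Bezoutp d d'.
pose g := p * d + q * d'; rewrite -/g in eq_g.
have g_d : g %| d by rewrite (eqp_dvdl _ eq_g) dvdp_gcdl.
have g_d' : g %| d' by rewrite (eqp_dvdl _ eq_g) dvdp_gcdr.
apply: (IHn g).
- rewrite -ltnS; apply: leq_trans le_dn; rewrite ltn_neqAle dvdp_leq // andbT.
  rewrite (dvdp_size_eqp g_d); apply: contra nz_d' => gd.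
  by rewrite -rootE (root_dvdp g_d') // (eqp_root gd).
- by apply: denominator_lin; [exists u|].
by apply: contraTneq g_d => ->; rewrite dvd0p.
Qed.

(** A root of the norm is the abscissa of a zero of the function or of its
    conjugate, so the norm is constant, and then B = 0 and A is constant. *)
Lemma aff_val_no_zero u : (forall x y, affine x y -> aff_val u x y != 0) ->
  exists2 c, c != 0 & u = aff_const c.
Proof.
move=> nz_u; have sz1 : size (aff_norm a b u) = 1%N.
  apply/eqP; apply: contraT => /closed_rootP[x].
  have [y xy] := affine_ex a b x; rewrite rootE (aff_norm_val _ xy) mulf_eq0.
  by rewrite (negPf (nz_u _ _ xy)) (negPf (nz_u _ _ (affine_opp xy))).
move: sz1; rewrite size_aff_norm => sz1.
have u2_0 : u.2 = 0.
  by move: sz1; case: eqP => // _ sz1;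
      have := leq_maxr (size u.1).*2.-1 (size u.2).*2.+2; rewrite sz1.
move: sz1; rewrite u2_0 eqxx maxn0 => sz1.
have /size_poly1P[c nz_c u1c] : size u.1 == 1%N.
  by case: (size u.1) sz1 => [|[|n]] //; rewrite !doubleS.
by exists c => //; rewrite [LHS]surjective_pairing u1c u2_0.
Qed.

End RegularFunctions.

(** * Isomorphisms of Weierstrass cubics *)

Section AffineIsomorphism.
Variable K : numClosedFieldType.
Variables a b a' b' : K.
Implicit Types (u v w : {poly K} * {poly K}).

(** Let u, v be the coordinates of the map. From v^2 = u^3 + a' u + b' the
    pole orders of u and v are 2k and 3k. Since x is a polynomial w_1(u) +
    w_2(u) v in u and v, whose terms have orders 2km and 2kn + 3k, its order 2
    must be 2km, so k = 1. Hence u = alpha x + beta and v is d y plus a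
    polynomial of degree at most 1 in x; comparing coefficients in the
    equation leaves u = alpha x and v = d y with d^2 = alpha^3. *)
Lemma affine_isomorphism u v w :
  (forall x y, affine a b x y ->
      affine a' b' (aff_val u x y) (aff_val v x y)) ->
  (forall x y, affine a b x y ->
      aff_val w (aff_val u x y) (aff_val v x y) = x) ->
  exists2 c, c != 0 & a' = c ^+ 2 * a /\ b' = c ^+ 3 * b.
Proof.
move=> curve_uv w_uv.
pose p : {poly K} := poly3 b' a' 0 1.
have sz_p : size p = 4%N by rewrite /p -(cubicE a' b') size_cubic.
have v2E : aff_mul a b v v = aff_comp a b p u.
  apply: (@aff_val_eq _ a b) => x y xy;
      rewrite (aff_val_mul _ _ xy) (aff_val_comp _ _ xy).
  by rewrite -expr2 (curve_uv _ _ xy) horner_poly3; ring.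
have wE : aff_add (aff_comp a b w.1 u) (aff_mul a b (aff_comp a b w.2 u) v) =
    ('X, 0).
  apply: (@aff_val_eq _ a b) => x y xy.
  rewrite aff_val_add (aff_val_mul _ _ xy) !(aff_val_comp _ _ xy).
  by rewrite -[LHS]/(aff_val w (aff_val u x y) (aff_val v x y)) w_uv //
      /aff_val /= hornerX
    horner0 mul0r addr0.
have nz_w : ('X, 0) != (0, 0) :> {poly K} * {poly K}.
  by rewrite xpair_eqE negb_and polyX_eq0.
have ordX : aff_ord a b ('X, 0) = 2%N.
  by rewrite /aff_ord size_aff_norm /= size_polyX eqxx.
have ord_const z : aff_ord a b z = 0%N -> z = aff_const z.1`_0.
  rewrite /aff_ord size_aff_norm -!addnn => e; have z2_0 : z.2 = 0.
    by move: e; case: eqP => // _; move: (size z.1) (size z.2) => m n e;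
        exfalso; lia.
  move: e; rewrite z2_0 eqxx maxn0 => e.
  rewrite [LHS]surjective_pairing z2_0; congr (_, _); apply: size1_polyC.
  by move: (size z.1) e => m; lia.
have ord_v2 : v != (0, 0) ->
    (aff_ord a b v + aff_ord a b v)%N = aff_ord a b (aff_comp a b p u).
  by move=> nz_v; rewrite -v2E aff_ord_mul.
(* If u were constant, so would be v, and x as a function of u and v. *)
have [ou0 | ou_gt0] := posnP (aff_ord a b u).
  have uc := ord_const u ou0.
  have v2c : aff_comp a b p u = aff_const p.[u.1`_0].
    apply: (@aff_val_eq _ a b) => x y xy.
    by rewrite (aff_val_comp _ _ xy) {1}uc !aff_val_const.
  have vc : v = aff_const v.1`_0.
    have [-> | /ord_v2] := eqVneq v (0, 0);
        first by rewrite /aff_const /= coef0 polyC0.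
    by rewrite v2c aff_ord_const => /eqP;
        rewrite addn_eq0 andbb => /eqP/ord_const.
  have const_x x : x = aff_val w u.1`_0 v.1`_0.
    have [y xy] := affine_ex a b x.
    by rewrite -{1}(w_uv x y xy) uc vc !aff_val_const /= !coefC /=.
  by have /eqP := const_x 1; rewrite -(const_x 0) oner_eq0.
have ord_p : aff_ord a b (aff_comp a b p u) =
    (3 * aff_ord a b u)%N by rewrite aff_ord_comp // sz_p.
have nz_v : v != (0, 0).
  have : aff_mul a b v v != (0, 0).
    by rewrite v2E; apply: (@aff_ord_neq0 _ a b); rewrite ord_p muln_gt0.
  by apply: contraNneq => ->; rewrite /aff_mul /= !mulr0 !mul0r !addr0.
have ord_uv : (2 * aff_ord a b v = 3 * aff_ord a b u)%N.
  by rewrite -ord_p -(ord_v2 nz_v) mul2n addnn.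
have ord_23 n : 2%N = (n * aff_ord a b u)%N ->
    aff_ord a b u = 2%N /\ aff_ord a b v = 3%N.
  move: (aff_ord a b u) (aff_ord a b v) ord_uv => [|[|[|k]]] m; try lia.
  by case: n => [|n]; nia.
have [ou ov] : aff_ord a b u = 2%N /\ aff_ord a b v = 3%N.
  have [w2_0 | nz_w2] := eqVneq w.2 0.
    have {}wE : aff_comp a b w.1 u = ('X, 0).
      rewrite -wE w2_0 /aff_comp polyseq0 /= /aff_mul /aff_add /= !mul0r !addr0.
      exact: surjective_pairing.
    have := aff_ord_comp w.1 ou_gt0; rewrite wE ordX.
    exact: ord_23.
  have nz_cw : aff_comp a b w.2 u != (0, 0).
    have [sz1 | sz_n1] := eqVneq (size w.2) 1%N.
      have /size_poly1P[c nz_c wc] : size w.2 == 1%N by rewrite sz1.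
      rewrite /aff_comp wc polyseqC nz_c /= /aff_mul /aff_add /= !mul0r !addr0
          add0r.
      by rewrite xpair_eqE polyC_eq0 (negPf nz_c).
    apply: (@aff_ord_neq0 _ a b); rewrite aff_ord_comp // muln_gt0 ou_gt0 andbT.
    by move: sz_n1; rewrite -size_poly_eq0 in nz_w2;
        case: (size w.2) nz_w2 => [|[]].
  have ordP := aff_ord_comp w.1 ou_gt0.
  have ordQ : aff_ord a b (aff_mul a b (aff_comp a b w.2 u) v) =
      ((size w.2).-1 * aff_ord a b u + aff_ord a b v)%N by rewrite aff_ord_mul
          // aff_ord_comp.
  case: (ltngtP (aff_ord a b (aff_comp a b w.1 u))
                (aff_ord a b (aff_mul a b (aff_comp a b w.2 u) v))) => [lt |
                    lt | eq].
  - by have := aff_ord_add lt; rewrite wE ordX ordQ; move: ord_uv ou_gt0; nia.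
  - by have := aff_ord_add lt; rewrite aff_addC wE ordX ordP; exact: ord_23.
  move: eq; rewrite ordP ordQ; move: (size w.1).-1 (size w.2).-1 => m n eq.
  have : (2 * m == 2 * n + 3)%N.
    rewrite -(eqn_pmul2r ou_gt0) mulnDl -ord_uv -!mulnA -mulnDr eq.
    by rewrite eqxx.
  by lia.
have [sz_u u2_0] : size u.1 = 2%N /\ u.2 = 0.
  move: ou; rewrite /aff_ord size_aff_norm -!addnn.
  case: eqVneq => [->|]; first by rewrite maxn0; move: (size u.1) => m;
      split=> //; lia.
  rewrite -size_poly_eq0.
  by move: (size u.1) (size u.2) => m n nz e; exfalso; lia.
have [nz_v2 sz_v2] : v.2 != 0 /\ size v.2 = 1%N.
  move: ov; rewrite /aff_ord size_aff_norm -!addnn; case: eqVneq => [_|].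
    by rewrite maxn0; move: (size v.1) => m e; exfalso; lia.
  move=> nz e; split=> //; move: nz e; rewrite -size_poly_eq0.
  by move: (size v.1) (size v.2) => m n; lia.
have eq2 : aff_mul a b v v = (u.1 ^+ 3 + a'%:P * u.1 + b'%:P, 0).
  apply: (@aff_val_eq _ a b) => x y xy;
      rewrite v2E (aff_val_comp _ _ xy) horner_poly3.
  rewrite /aff_val u2_0 /= !(hornerD, hornerM, horner_exp, hornerC); ring.
have v1_0 : v.1 = 0.
  have /eqP := congr1 snd eq2; rewrite /= mulrC -mulr2n -scaler_nat scaler_eq0.
  rewrite pnatr_eq0 mulf_eq0.
  by rewrite (negPf nz_v2) /= => /eqP.
have /size_poly1P[d nz_d v2d] : size v.2 == 1%N by rewrite sz_v2.
have u1E : u.1 = poly3 u.1`_0 u.1`_1 0 0.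
  apply/polyP => -[|[|k]]; rewrite coef_poly3 //=.
  by rewrite nth_default ?sz_u //; case: k => [|[|k]] //=; rewrite nth_nil.
have alpha_neq0 : u.1`_1 != 0 by have := lead_coef_eq0 u.1;
  rewrite /lead_coef sz_u /= => ->; rewrite -size_poly_eq0 sz_u.
move: u.1`_0 u.1`_1 u1E alpha_neq0 => beta alpha u1E nz_alpha.
have := congr1 fst eq2; rewrite /= v1_0 mul0r add0r v2d u1E.
have -> : d%:P * d%:P * cubic a b = poly3 (d ^+ 2 * b) (d ^+ 2 * a) 0 (d ^+ 2).
  by apply: poly_ext => t; rewrite cubicE /poly3 !(hornerD, hornerM,
      horner_exp, hornerC, hornerX); ring.
have -> : poly3 beta alpha 0 0 ^+ 3 + a'%:P * poly3 beta alpha 0 0 + b'%:P =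
    poly3 (beta ^+ 3 + a' * beta + b') (3 * alpha * beta ^+ 2 + a' * alpha)
          (3 * alpha ^+ 2 * beta) (alpha ^+ 3).
  apply: poly_ext => t.
  by rewrite /poly3 !(hornerD, hornerM, horner_exp, hornerC, hornerX); ring.
move=> e; have coef k := congr1 (fun q : {poly K} => q`_k) e.
have := coef 3%N; have := coef 2%N; have := coef 1%N; have := coef 0%N.
rewrite !coef_poly3 /= => e0 e1 e2 e3.
have beta0 : beta = 0.
  apply: (mulfI (_ : 3 * alpha ^+ 2 != 0)); last by rewrite -e2 mulr0.
  by rewrite mulf_neq0 ?expf_neq0 // pnatr_eq0.
exists alpha => //; split; last by rewrite -e3 e0 beta0; ring.
by apply: (mulIf nz_alpha); rewrite mulrAC -exprSr -e3 e1 beta0; ring.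
Qed.

End AffineIsomorphism.

Section Invariants.
Variable K : numClosedFieldType.
Implicit Types (P Q : 'rV[K]_3).

Let O : 'rV[K]_3 := vec3 0 1 0.

Lemma weier_infty_on_curve (a b : K) : on_curve (weier a b) O.
Proof. by split; rewrite ?vec3_eq0 ?oner_eq0 ?andbF // ev_weier3; ring. Qed.

Lemma on_weier_affine (a b : K) P : on_curve (weier a b) P ->
    ~ proportional P O ->
  exists x y, affine a b x y /\ proportional P (vec3 x y 1).
Proof.
rewrite (vec3_eta P); move: (P 0 i0) (P 0 i1) (P 0 i2) => x y z EP notO.
have [z0 | nz_z] := eqVneq z 0.
  case: notO; move: EP; rewrite z0 => /on_weier_infty[-> nz_y]; exists y => //.
  by apply: row3P; rewrite !mxE /= ?mulr0 ?mulr1.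
have scaleP : vec3 x y z = z *: vec3 (x / z) (y / z) 1.
  by apply: row3P; rewrite !mxE /=; field.
exists (x / z), (y / z); split; last by rewrite scaleP; exact: proportionalZ.
apply/affineP; apply: (on_curve_proportional (weier_homog a b)) EP.
by rewrite scaleP; exact/proportional_sym/proportionalZ.
Qed.

(** The quotients of the coordinates of the image are locally fractions of
    forms, and forms restrict to elements of the coordinate ring. *)
Lemma morphism_coordinates (a b a' b' : K) phi :
  curve_morphism (weier a b) (weier a' b') phi ->
  (forall x y, affine a b x y -> ~ proportional (phi (vec3 x y 1)) O) ->
  exists u v, forall x y, affine a b x y ->
    affine a' b' (aff_val u x y) (aff_val v x y) /\
    proportional (phi (vec3 x y 1)) (vec3 (aff_val u x y) (aff_val v x y) 1).
Proof.
move=> [Mphi loc_phi] notO.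
pose coord i x y := phi (vec3 x y 1) 0 i / phi (vec3 x y 1) 0 i2.
have phiP x y : affine a b x y -> exists x' y', [/\ affine a' b' x' y',
    proportional (phi (vec3 x y 1)) (vec3 x' y' 1), coord i0 x y = x'
    & coord i1 x y = y'].
  move=> xy; have := on_weier_affine (Mphi _ ((affineP a b x y).1 xy)) (notO x
      y xy).
  case=> x' [y' [xy' prop']]; exists x', y'; split=> //.
    by case: prop' => c nz_c; rewrite /coord => ->; rewrite !mxE /=; field.
  by case: prop' => c nz_c; rewrite /coord => ->; rewrite !mxE /=; field.
have reg i : regular a b (coord i).
  apply: locally_regular => x0 y0 xy0.
  have [e [d [h [g [nz_h phiE]]]]] := loc_phi _ ((affineP a b x0 y0).1 xy0).
  have [u eu] := regular_ev a b (g i); have [v ev] := regular_ev a b (g i2).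
  have [w ew] := regular_ev a b h.
  exists (aff_mul a b w u), (aff_mul a b w v); split.
    have [c nz_c eP] := phiE _ ((affineP a b x0 y0).1 xy0) nz_h.
    rewrite (aff_val_mul _ _ xy0) -ew // -ev // mulf_neq0 //.
    have [x' [y' [_ [c' nz_c' e'] _ _]]] := phiP _ _ xy0.
    have := congr1 (fun P : 'rV_3 => P 0 i2) eP; rewrite e' !mxE /= mulr1.
    by move=> c'E; apply: contraNneq nz_c' => g0; rewrite c'E g0 mulr0.
  move=> x y xy; rewrite !(aff_val_mul _ _ xy) mulf_eq0 negb_or -ew // -ev //
      -eu //.
  case/andP=> nz_hx nz_g.
  have [c nz_c eP] := phiE _ ((affineP a b x y).1 xy) nz_hx.
  by rewrite /coord eP !mxE; field; rewrite ?nz_g ?nz_c.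
have [u eu] := reg i0; have [v ev] := reg i1; exists u, v => x y xy.
have [x' [y' [xy' prop' ex ey]]] := phiP x y xy.
by rewrite -eu // -ev // ex ey.
Qed.

(** The isomorphism is first composed with an automorphism of the source so
    that it sends the flex O to O; the affine curves then correspond, since
    they are the complements of O. *)
Lemma isomorphic_weier (a b a' b' : K) : disc a b != 0 ->
  isomorphic_curves (weier a b) (weier a' b') ->
  exists2 c, c != 0 & a' = c ^+ 2 * a /\ b' = c ^+ 3 * b.
Proof.
move=> nz_disc [phi [psi [Mphi Mpsi psiK phiK]]].
have O1 := weier_infty_on_curve a b; have O2 := weier_infty_on_curve a' b'.
have [tau [sigma [Mtau Msigma sigmaK tauK tauO]]] :=
  weier_move_point nz_disc (Mpsi.1 _ O2).
(* tau moves psi O to O, so that g fixes O; f is its inverse. *)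
pose f := phi \o sigma; pose g := tau \o psi.
have Mf : curve_morphism (weier a b) (weier a' b') f.
  exact: curve_morphism_comp Msigma Mphi.
have Mg : curve_morphism (weier a' b') (weier a b) g.
  exact: curve_morphism_comp Mpsi Mtau.
have gK P : on_curve (weier a b) P -> proportional (g (f P)) P.
  move=> EP; apply: proportional_trans (tauK P EP).
  have EsP := Msigma.1 _ EP; have EfP := Mf.1 _ EP.
  exact: (curve_morphism_proportional Mtau (Mpsi.1 _ EfP) EsP (psiK _ EsP)).
have fK P : on_curve (weier a' b') P -> proportional (f (g P)) P.
  move=> EP; apply: proportional_trans (phiK P EP).
  have EsP := Mpsi.1 _ EP; have EgP := Mg.1 _ EP.
  exact: (curve_morphism_proportional Mphi (Msigma.1 _ EgP) EsP (sigmaK _ EsP)).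
have gO : proportional (g O) O by [].
have fO : proportional (f O) O.
  apply: proportional_trans (fK O O2); apply: proportional_sym.
  exact: (curve_morphism_proportional Mf (Mg.1 _ O2) O1 gO).
have affine_notO x y : ~ proportional (vec3 x y 1 : 'rV[K]_3) O.
  case=> c _ /(congr1 (fun P : 'rV_3 => P 0 i2)) /eqP.
  by rewrite !mxE /= mulr0 oner_eq0.
have [x y xy Of | u [v uvE]] := morphism_coordinates Mf.
  have E1 := (affineP a b x y).1 xy; apply: (@affine_notO x y).
  apply: proportional_trans (proportional_sym (gK _ E1)) _.
  apply: proportional_trans gO.
  exact: (curve_morphism_proportional Mg (Mf.1 _ E1) O2 Of).
have [x y xy Og | w [w' wE]] := morphism_coordinates Mg.
  have E1 := (affineP a' b' x y).1 xy; apply: (@affine_notO x y).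
  apply: proportional_trans (proportional_sym (fK _ E1)) _.
  apply: proportional_trans fO.
  exact: (curve_morphism_proportional Mf (Mg.1 _ E1) O1 Og).
apply: (@affine_isomorphism _ a b a' b' u v w) => x y xy.
  by case: (uvE x y xy).
have [uv_xy f_uv] := uvE x y xy; have [w_xy g_w] := wE _ _ uv_xy.
have E1 := (affineP a b x y).1 xy.
have : proportional (vec3 (aff_val w (aff_val u x y) (aff_val v x y))
                          (aff_val w' (aff_val u x y) (aff_val v x y)) 1)
                              (vec3 x y 1).
  apply: proportional_trans (proportional_sym g_w) _.
  apply: proportional_trans (gK _ E1); apply: proportional_sym.
  exact: (curve_morphism_proportional Mg (Mf.1 _ E1) ((affineP _ _ _ _).1
      uv_xy) f_uv).
case=> c nz_c e; have c1 : 1 = c.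
  by have := congr1 (fun P : 'rV_3 => P 0 i2) e; rewrite !mxE /= mulr1.
by have := congr1 (fun P : 'rV_3 => P 0 i0) e; rewrite !mxE /= -c1 mul1r.
Qed.

End Invariants.

(** * Reduction to Weierstrass form *)

Section NormalForm.
Variable K : numClosedFieldType.
Implicit Types (F G H l : {mpoly K[3]}) (P Q : 'rV[K]_3) (c : K).

Lemma unitmx_inj (M : 'M[K]_3) : (forall P, P *m M = 0 -> P = 0) ->
    M \in unitmx.
Proof. by move=> injM; rewrite -row_free_unit; apply: inj_row_free. Qed.

Definition rows3 P0 P1 P2 : 'M[K]_3 := \matrix_(i < 3) [:: P0; P1; P2]`_i.

Lemma mul_rows3 x y z P0 P1 P2 :
  vec3 x y z *m rows3 P0 P1 P2 = x *: P0 + y *: P1 + z *: P2.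
Proof. by rewrite mulmx_sum_row sum3 !rowK !vec3E. Qed.

(** A frame in which P is the second basis vector and the linear form l, which
    vanishes at P, is a multiple of the last coordinate. *)
Lemma flag_frame (l : 'cV[K]_3) P : P != 0 -> l != 0 -> P *m l = 0 ->
  exists A : 'M[K]_3, [/\ A \in unitmx, vec3 0 1 0 *m A = P
    & exists2 m, m != 0 & forall Q, (Q *m A *m l) 0 0 = Q 0 i2 * m].
Proof.
move=> nzP nz_l Pl.
have [i nz_li] : exists i, l i 0 != 0.
  apply/existsP; apply: contraNT nz_l => /existsPn l0.
  by apply/eqP/matrixP => i j; rewrite mxE (ord1 j); apply/eqP/negPn/l0.
have [j notP] : exists j, ~~ (row j (kermx l) <= P)%MS.
  apply/existsP; apply: contraT => /existsPn ker_le.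
  have : (kermx l <= P)%MS by apply/row_subP => j; apply/negPn/ker_le.
  move/mxrankS; rewrite mxrank_ker => le_r.
  have := leq_trans le_r (rank_leq_row P).
  by rewrite leq_subLR; have := rank_leq_col l; case: (\rank l) => [|[]].
pose r0 := row j (kermx l); pose r2 : 'rV[K]_3 := delta_mx 0 i.
have r0l : r0 *m l = 0 by apply: sub_kermxP; exact: row_sub.
have r2l : (r2 *m l) 0 0 = l i 0 by rewrite -rowE mxE.
have lA x y z : (vec3 x y z *m rows3 r0 P r2 *m l) 0 0 = z * l i 0.
  rewrite mul_rows3 !mulmxDl -!scalemxAl r0l Pl !scaler0 !add0r.
  by rewrite mxE r2l.
exists (rows3 r0 P r2); split.
- apply: unitmx_inj => Q; rewrite (vec3_eta Q).
  move: (Q 0 i0) (Q 0 i1) (Q 0 i2) => x y z Q0.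
  have z0 : z = 0.
    by apply: (mulIf nz_li); rewrite mul0r -(lA x y) Q0 mul0mx mxE.
  move: Q0; rewrite mul_rows3 z0 scale0r addr0 => Q0.
  have x0 : x = 0.
    have r0P : x *: r0 = - y *: P by apply/eqP; rewrite scaleNr -addr_eq0 Q0.
    apply: contraNeq notP => nz_x;
        rewrite -[row j _]scale1r -(mulVf nz_x) -scalerA.
    by rewrite r0P scalerA scalemx_sub.
  move/eqP: Q0; rewrite x0 scale0r add0r scaler_eq0 (negPf nzP) orbF => /eqP->.
  by apply/eqP; rewrite vec3_eq0 eqxx.
- by rewrite mul_rows3 !scale0r scale1r add0r addr0.
by exists (l i 0) => // Q; rewrite {1}(vec3_eta Q) lA.
Qed.

(** The equation of a cubic with a flex at (0:1:0) and flex tangent Z = 0 has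
    no term in Y^3, X Y^2 or X^2 Y. *)
Lemma flex_cubicP F : F \is 3.-homog -> ev F (vec3 0 1 0) = 0 ->
  (exists2 m, m != 0 & forall Q, (along F (vec3 0 1 0) Q)`_1 = Q 0 i2 * m) ->
  (forall Q, Q 0 i2 = 0 -> 'X^3 %| along F (vec3 0 1 0) Q) ->
  exists k m e f g h j, m != 0 /\
    F = k *: 'X_i0 ^+ 3 + m *: ('X_i1 ^+ 2 * 'X_i2) + e *: ('X_i0 * 'X_i1 *
        'X_i2)
     + f *: ('X_i1 * 'X_i2 ^+ 2) + g *: ('X_i0 ^+ 2 * 'X_i2)
     + h *: ('X_i0 * 'X_i2 ^+ 2) + j *: 'X_i2 ^+ 3.
Proof.
move=> homF F0 [m nz_m F1] F2; have [c cF] := cubicP homF.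
have evF x y z : ev F (vec3 x y z) =
   (c 3 0 0)%N * x ^+ 3 + (c 2 1 0)%N * x ^+ 2 * y
  + (c 2 0 1)%N * x ^+ 2 * z + (c 1 2 0)%N * x * y ^+ 2
  + (c 1 1 1)%N * x * y * z + (c 1 0 2)%N * x * z ^+ 2
  + (c 0 3 0)%N * y ^+ 3 + (c 0 2 1)%N * y ^+ 2 * z
  + (c 0 1 2)%N * y * z ^+ 2 + (c 0 0 3)%N * z ^+ 3.
  by rewrite {1}cF !evE !vec3E; ring.
have c030 : (c 0 3 0)%N = 0 by rewrite -F0 evF; ring.
have alongF u w : along F (vec3 0 1 0) (vec3 u 0 w) = poly3 0
    ((c 1 2 0)%N * u + (c 0 2 1)%N * w)
    ((c 2 1 0)%N * u ^+ 2 + (c 1 1 1)%N * u * w + (c 0 1 2)%N * w ^+ 2)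
    ((c 3 0 0)%N * u ^+ 3 + (c 2 0 1)%N * u ^+ 2 * w + (c 1 0 2)%N * u * w ^+ 2
      + (c 0 0 3)%N * w ^+ 3).
  apply: poly_ext => t; rewrite horner_along (vec3_eta (_ + _)) !mxE /= evF.
  by rewrite horner_poly3 c030; ring.
have c120 : (c 1 2 0)%N = 0.
  have := F1 (vec3 1 0 0); rewrite alongF coef_poly3 vec3E mul0r /= => <-; ring.
have c021 : (c 0 2 1)%N = m.
  by have := F1 (vec3 0 0 1); rewrite alongF coef_poly3 vec3E mul1r /= => <-;
      ring.
have c210 : (c 2 1 0)%N = 0.
  have /dvdpP[q] := F2 (vec3 1 0 0) (vec3E2 _ _ _).
  rewrite alongF => /(congr1 (fun p : {poly K} => p`_2)).
  by rewrite coef_poly3 coefMXn /= => <-; ring.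
exists (c 3 0 0)%N, m, (c 1 1 1)%N, (c 0 1 2)%N, (c 2 0 1)%N, (c 1 0 2)%N, (c
    0 0 3)%N.
split=> //; rewrite {1}cF c030 c120 c021 c210 -!mul_mpolyC !mpolyC0.
ring.
Qed.

End NormalForm.

Section WeierstrassForm.
Variable K : numClosedFieldType.
Implicit Types (F G H l : {mpoly K[3]}) (P Q : 'rV[K]_3) (c : K).

(** If k = 0 the cubic is Z times a conic, and it is singular where the line
    meets the conic; the conic does meet the line off (0:1:0), because m is
    nonzero. *)
Lemma flex_cubic_lead_neq0 k m e f g h j : m != 0 ->
  smooth_curve (k *: 'X_i0 ^+ 3 + m *: ('X_i1 ^+ 2 * 'X_i2)
     + e *: ('X_i0 * 'X_i1 * 'X_i2)
     + f *: ('X_i1 * 'X_i2 ^+ 2) + g *: ('X_i0 ^+ 2 * 'X_i2)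
     + h *: ('X_i0 * 'X_i2 ^+ 2) + j *: 'X_i2 ^+ 3 : {mpoly K[3]}) -> k != 0.
Proof.
move=> nz_m; set F := _ + _; apply: contra_notN => /eqP k0.
pose s := sqrtC (e ^+ 2 - 4 * m * g); pose y := (s - e) / (2 * m).
have y_root : g + e * y + m * y ^+ 2 = 0.
  have s2 : s ^+ 2 = e ^+ 2 - 4 * m * g by rewrite sqrtCK.
  have -> : g + e * y + m * y ^+ 2 = (s ^+ 2 - (e ^+ 2 - 4 * m * g)) / (4 * m).
    by rewrite /y; field.
  by rewrite s2 subrr mul0r.
exists (vec3 1 y 0); apply/singular_atP; split.
  split; first by rewrite vec3_eq0 oner_eq0.
  by rewrite !evE !vec3E k0; ring.
move=> Q; rewrite (vec3_eta Q); move: (Q 0 i0) (Q 0 i1) (Q 0 i2) => u v w.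
have -> : along F (vec3 1 y 0) (vec3 u v w) =
    poly3 0 (w * (g + e * y + m * y ^+ 2))
   (w * (2 * g * u + e * (v + y * u) + h * w + 2 * m * y * v + f * y * w))
   (w * (g * u ^+ 2 + e * u * v + h * u * w + m * v ^+ 2 + f * v * w + j * w
       ^+ 2)).
  apply: poly_ext => t.
  by rewrite horner_along horner_poly3 !evE !mxE /= k0; ring.
by rewrite coef_poly3 /= y_root mulr0.
Qed.

(** Completing the square in Y and the cube in X: the substitution is Y -> k
    (Y + p X + q Z), X -> k (X - r Z), Z -> k s Z, where k^3 absorbs the
    leading coefficient. *)
Lemma complete_weier (k s p q r a b c0 m e f g h j : K) :
  let B := rows3 (vec3 k (k * p) 0) (vec3 0 k 0) (vec3 (- k * r) (k * q) (k *
      s)) in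
  c0 = - k ^+ 3 -> m = k ^+ 3 * s -> e = 2 * k ^+ 3 * s * p ->
  f = 2 * k ^+ 3 * s * q -> g = k ^+ 3 * (3 * r + s * p ^+ 2) ->
  h = k ^+ 3 * (2 * s * p * q - 3 * r ^+ 2 - a * s ^+ 2) ->
  j = k ^+ 3 * (s * q ^+ 2 + r ^+ 3 + a * s ^+ 2 * r - b * s ^+ 3) ->
  c0 *: 'X_i0 ^+ 3 + m *: ('X_i1 ^+ 2 * 'X_i2) + e *: ('X_i0 * 'X_i1 * 'X_i2)
     + f *: ('X_i1 * 'X_i2 ^+ 2) + g *: ('X_i0 ^+ 2 * 'X_i2)
     + h *: ('X_i0 * 'X_i2 ^+ 2) + j *: 'X_i2 ^+ 3 = lsub B (weier a b).
Proof.
move=> B -> -> -> -> -> -> ->;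
    have BX0 : lsub B 'X_i0 = k *: 'X_i0 - (k * r) *: 'X_i2.
  by rewrite lsubX sum3 !mxE /= scale0r addr0 mulNr scaleNr.
have BX1 : lsub B 'X_i1 = (k * p) *: 'X_i0 + k *: 'X_i1 + (k * q) *: 'X_i2.
  by rewrite lsubX sum3 !mxE.
have BX2 : lsub B 'X_i2 = (k * s) *: 'X_i2.
  by rewrite lsubX sum3 !mxE /= !scale0r !add0r.
rewrite /weier !(lsubD, lsubB, lsubN, lsubZ, lsubM, lsubXn) BX0 BX1 BX2.
rewrite -!mul_mpolyC.
rewrite !(mpolyCD, mpolyCB, mpolyCN, mpolyCM, mpolyC_nat, rmorphXn) /=.
ring.
Qed.

Lemma complete_weier_unit (k s p q r : K) : k != 0 -> s != 0 ->
  rows3 (vec3 k (k * p) 0) (vec3 0 k 0) (vec3 (- k * r) (k * q) (k * s)) \in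
      unitmx.
Proof.
move=> nz_k nz_s; apply: unitmx_inj => P; rewrite (vec3_eta P).
move: (P 0 i0) (P 0 i1) (P 0 i2) => x y z; rewrite mul_rows3 => e.
have e0 := congr1 (fun P : 'rV_3 => P 0 i0) e.
have e1 := congr1 (fun P : 'rV_3 => P 0 i1) e.
have e2 := congr1 (fun P : 'rV_3 => P 0 i2) e.
move: e0 e1 e2; rewrite !mxE /= => e0 e1 e2.
have z0 : z = 0.
  by apply: (mulIf (mulf_neq0 nz_k nz_s)); rewrite mul0r -e2; ring.
have x0 : x = 0 by apply: (mulIf nz_k); rewrite mul0r -e0 z0; ring.
have y0 : y = 0 by apply: (mulIf nz_k); rewrite mul0r -e1 z0 x0; ring.
by apply/eqP; rewrite x0 y0 z0 vec3_eq0 eqxx.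
Qed.

Lemma tangent_line_ev F P Q : ev (tangent_line F P) Q = (along F P Q)`_1.
Proof.
rewrite along_coef1 /tangent_line sum3 !evE [RHS]sum3; ring.
Qed.

Lemma linear_form_ext (c d : 'I_3 -> K) :
  (forall Q, ev (\sum_i c i *: 'X_i) Q = ev (\sum_i d i *: 'X_i) Q) ->
  \sum_i c i *: 'X_i = \sum_i d i *: 'X_i :> {mpoly K[3]}.
Proof.
move=> e; apply: eq_bigr => i _; congr (_ *: _).
have ev_delta (g : 'I_3 -> K) : ev (\sum_j g j *: 'X_j) (delta_mx 0 i) = g i.
  by rewrite sum3 !evE !mxE /= -(sum3 (fun j => g j * (j == i)%:R)) (bigD1 i)
      //=
    eqxx mulr1 big1 ?addr0 // => j /negPf->; rewrite mulr0.
by rewrite -(ev_delta c) e ev_delta.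
Qed.

Theorem weierstrass_form C P : C \is 3.-homog -> smooth_curve C -> flex C P ->
  exists (M : 'M[K]_3) (a b : K), [/\ M \in unitmx, C = lsub M (weier a b),
    proportional (P *m M) (vec3 0 1 0)
    & proportional (tangent_line C P) (lsub M 'X_i2)].
Proof.
move=> homC smC [[nzP CP] nsP flexP].
pose l : 'cV[K]_3 := \col_i ev C^`M(i) P.
have lE Q : (Q *m l) 0 0 = (along C P Q)`_1.
  by rewrite along_coef1 mxE; apply: eq_bigr => i _; rewrite mxE mulrC.
have nz_l : l != 0.
  apply: contra_notN nsP => /eqP l0; split=> // i.
  by have := congr1 (fun A : 'cV_3 => A i 0) l0; rewrite !mxE.
have Pl : P *m l = 0.
  apply/matrixP => i j; rewrite (ord1 i) (ord1 j) lE mxE.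
  suff -> : along C P P = 0 by rewrite coef0.
  apply: poly_ext => t; rewrite horner_along horner0 -{1}[P]scale1r -scalerDl.
  by rewrite (ev_homogZ _ _ homC) CP mulr0.
have [A [uA AP [m nz_m lA]]] := flag_frame nzP nz_l Pl.
have CA1 Q : (along (lsub A C) (vec3 0 1 0) Q)`_1 = Q 0 i2 * m.
  by rewrite along_lsub AP -lE lA.
have [||Q Q2|k [m' [e [f [g [h [j [nz_m' CA]]]]]]]] :=
    @flex_cubicP _ (lsub A C) (lsub_homog A homC).
- by rewrite ev_lsub AP.
- by exists m.
- by rewrite along_lsub AP; apply: flexP;
    rewrite tangent_line_ev -lE lA Q2 mul0r.
have nz_k : k != 0.
  have : smooth_curve (lsub A C) by move=> /(singular_curve_lsub uA).
  by rewrite CA; exact: flex_cubic_lead_neq0.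
pose r3 := 3.-root (- k); have r3E : r3 ^+ 3 = - k by rewrite rootCK.
have nz_r3 : r3 != 0 by rewrite rootC_eq0 // oppr_eq0.
have kE : k = - r3 ^+ 3 by rewrite r3E opprK.
pose s := m' / r3 ^+ 3; pose p := e / (2 * m'); pose q := f / (2 * m').
have nz_s : s != 0 by rewrite mulf_neq0 ?invr_eq0 ?expf_neq0.
pose r := (g / r3 ^+ 3 - s * p ^+ 2) / 3.
pose a := (2 * s * p * q - 3 * r ^+ 2 - h / r3 ^+ 3) / s ^+ 2.
pose b := (s * q ^+ 2 + r ^+ 3 + a * s ^+ 2 * r - j / r3 ^+ 3) / s ^+ 3.
pose B := rows3 (vec3 r3 (r3 * p) 0) (vec3 0 r3 0) (vec3 (- r3 * r) (r3 * q)
    (r3 * s)).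
have uB : B \in unitmx by exact: complete_weier_unit.
have CB : lsub A C = lsub B (weier a b).
  rewrite CA; apply: complete_weier => //.
  - by rewrite /s; field.
  - by rewrite /p /s; field; rewrite nz_m'.
  - by rewrite /q /s; field; rewrite nz_m'.
  - by rewrite /r; field.
  - by rewrite /a; field; rewrite nz_r3 nz_s.
  by rewrite /b; field; rewrite nz_r3 nz_s.
exists (invmx A *m B), a, b; split.
- by rewrite unitmx_mul unitmx_inv uA.
- by rewrite -lsub_lsub -CB lsubVK.
- rewrite mulmxA -AP mulmxK // mul_rows3 !scale0r scale1r add0r addr0.
  by exists r3 => //; apply: row3P; rewrite !mxE /= ?mulr0 ?mulr1.
exists (m / (r3 * s)); first by rewrite mulf_neq0 // invr_eq0 mulf_neq0.
rewrite lsubX scaler_sumr (eq_bigr _ (fun i _ => scalerA _ _ _)).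
apply: linear_form_ext => Q.
rewrite -[LHS]/(ev (tangent_line C P) Q) tangent_line_ev -lE -{1}(mulmxKV uA
    Q) lA.
rewrite -(eq_bigr _ (fun i _ => scalerA _ _ _)) -scaler_sumr evZ -lsubX
    lsubX_coord.
rewrite mulmxA; move: (Q *m invmx A) => T.
rewrite {2}(vec3_eta T) mul_rows3 !mxE /= !mulr0 !add0r.
by field; rewrite nz_r3 nz_s.
Qed.

(** The function G(x, y, 1) is a nonzero constant by [aff_val_no_zero];
    reducing y^2 modulo the equation of the curve, this determines the
    coefficients of G. *)
Lemma cubic_no_affine_zero (a b : K) G : G \is 3.-homog ->
  (forall x y, affine a b x y -> ev G (vec3 x y 1) != 0) ->
  exists mu nu, nu != 0 /\ G = mu *: weier a b + nu *: 'X_i2 ^+ 3.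
Proof.
move=> homG nzG; have [c cG] := cubicP homG.
have evG x y : ev G (vec3 x y 1) =
   (c 3 0 0)%N * x ^+ 3 + (c 2 1 0)%N * x ^+ 2 * y
  + (c 2 0 1)%N * x ^+ 2 + (c 1 2 0)%N * x * y ^+ 2
  + (c 1 1 1)%N * x * y + (c 1 0 2)%N * x
  + (c 0 3 0)%N * y ^+ 3 + (c 0 2 1)%N * y ^+ 2
  + (c 0 1 2)%N * y + (c 0 0 3)%N.
  by rewrite {1}cG !evE !vec3E; ring.
pose w1 : {poly K} := poly3 (c 0 0 3)%N (c 1 0 2)%N (c 2 0 1)%N (c 3 0 0)%N
  + poly3 (c 0 2 1)%N (c 1 2 0)%N 0 0 * poly3 b a 0 1.
pose w2 : {poly K} := poly3 ((c 0 1 2)%N + (c 0 3 0)%N * b) ((c 1 1 1)%N + (c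
    0 3 0)%N * a)
  (c 2 1 0)%N (c 0 3 0)%N.
have wE x y : affine a b x y -> aff_val (w1, w2) x y = ev G (vec3 x y 1).
  move=> xy; rewrite evG /aff_val /w1 /w2 /poly3 /=.
  rewrite !(hornerD, hornerM, horner_exp, hornerC, hornerX).
  by rewrite (exprSr y 2) xy; ring.
have [x y xy | d nz_d [w1E w2E]] := @aff_val_no_zero _ a b (w1, w2).
  by rewrite wE // nzG.
have w2k k := congr1 (fun q : {poly K} => q`_k) w2E.
have := w2k 0%N; have := w2k 1%N; have := w2k 2%N; have := w2k 3%N.
rewrite /w2 !coef_poly3 !coef0 /= => c030 c210;
    rewrite c030 !mul0r !addr0 => c111 c012.
have w1E' : w1 = poly3 ((c 0 0 3)%N + (c 0 2 1)%N * b)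
    ((c 1 0 2)%N + (c 0 2 1)%N * a + (c 1 2 0)%N * b)
    ((c 2 0 1)%N + (c 1 2 0)%N * a) ((c 3 0 0)%N + (c 0 2 1)%N)
    + (c 1 2 0)%N *: 'X^4.
  apply: poly_ext => t.
  by rewrite /w1 /poly3 !(hornerD, hornerM, hornerZ, horner_exp, hornerC,
      hornerX); ring.
have w1k k := congr1 (fun q : {poly K} => q`_k) w1E.
have := w1k 0%N; have := w1k 1%N; have := w1k 2%N; have := w1k 3%N;
    have := w1k 4%N.
rewrite w1E' ![(_ + _ *: 'X^4)`_ _]coefD !coef_poly3 !coefZ !coefXn !coefC /=
    !mulr0 !addr0 mulr1 add0r.
move=> c120; rewrite c120 !mul0r !addr0 => c300 c201 c102 c003.
exists (c 0 2 1)%N, d; split=> //.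
have {}c300 : (c 3 0 0)%N = - (c 0 2 1)%N by apply/eqP; rewrite -addr_eq0 c300.
have {}c102 : (c 1 0 2)%N = - ((c 0 2 1)%N * a) by apply/eqP;
    rewrite -addr_eq0 c102.
have {}c003 : (c 0 0 3)%N = d - (c 0 2 1)%N * b by rewrite -c003 addrK.
rewrite {1}cG c030 c210 c111 c012 c120 c201 c300 c102 c003 /weier -!mul_mpolyC.
rewrite !(mpolyCD, mpolyCB, mpolyCN, mpolyCM, mpolyC0) /=.
by ring.
Qed.

End WeierstrassForm.

(** * The pencil in Weierstrass coordinates *)

Section VspacePencil.
Variables (K : fieldType) (V : vectType K).

(** This provides the second generator of the pencil. *)
Lemma dim2_complement (W : {vspace V}) (u : V) : \dim W = 2%N -> u \in W ->
    u != 0 ->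
  exists v, [/\ v \in W, forall c, v != c *: u
    & forall w, w \in W -> exists mu nu, w = mu *: u + nu *: v].
Proof.
move=> dimW Wu nz_u; pose U := <[u]>%VS; pose D := (W :\: U)%VS.
have UW : (U <= W)%VS by rewrite -memvE.
have dimD : \dim D = 1%N.
  have := dimv_cap_compl W U; rewrite (capv_idPr UW) dim_vline nz_u dimW.
  by rewrite add1n => -[].
pose v := vpick D.
have nz_v : v != 0 by rewrite vpick0 -dimv_eq0 dimD.
have Dv : v \in D by exact: memv_pick.
have Wv : v \in W by apply: subvP Dv; exact: diffvSl.
have notU c : v != c *: u.
  apply: contraNneq nz_v => vu.
  have : v \in (D :&: U)%VS by rewrite memv_cap Dv vu memvZ // memv_line.
  by rewrite capv_diff memv0.
have DE : D = <[v]>%VS.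
  by apply/eqP; rewrite eq_sym eqEdim -memvE Dv dim_vline nz_v dimD.
have WE : W = (D + U)%VS by rewrite addv_diff; apply/esym/addv_idPl.
exists v; split=> // w; rewrite {1}WE => /memv_addP[x Dx [y /vlineP[mu ->] ->]].
by move: Dx; rewrite DE => /vlineP[nu ->]; exists mu, nu; rewrite addrC.
Qed.

End VspacePencil.

Section Pencil.
Variable K : numClosedFieldType.
Implicit Types (F G H l : {mpoly K[3]}) (P Q : 'rV[K]_3) (c : K).
Implicit Types W : {vspace dhomog 3 K 3}.

Definition weier_pencil (M : 'M[K]_3) a b W := forall F, pencil_member W F <->
  exists mu nu, ((mu != 0) || (nu != 0)) /\
    F = lsub M (mu *: weier a b + nu *: 'X_i2 ^+ 3).

(** A zero of the second generator on the affine part of C would be a base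
    point other than P, so [cubic_no_affine_zero] applies to this generator. *)
Lemma pencil_weier W P C : \dim W = 2%N -> only_base_point W P ->
  pencil_member W C -> smooth_curve C -> flex C P ->
  exists (M : 'M[K]_3) (a b : K), [/\ M \in unitmx, weier_pencil M a b W,
    proportional (P *m M) (vec3 0 1 0)
    & proportional (tangent_line C P) (lsub M 'X_i2)].
Proof.
move=> dimW [_ uniqP] [nzC [u Wu Cu]] smC flexC.
have homC : C \is 3.-homog by rewrite Cu dhomog_is_dhomog.
have [M [a [b [uM CE PM tC]]]] := weierstrass_form homC smC flexC.
exists M, a, b; split=> //.
have nz_u : u != 0 by apply: contraNneq nzC => u0; rewrite Cu u0.
have [v [Wv notCu spanW]] := dim2_complement dimW Wu nz_u.
pose G : {mpoly K[3]} := lsub (invmx M) v.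
have homG : G \is 3.-homog by apply: lsub_homog; exact: dhomog_is_dhomog.
have [x y xy | mu [nu [nz_nu GE]]] := @cubic_no_affine_zero _ a b G homG.
  apply/negP => /eqP G0; have E1 := (affineP a b x y).1 xy.
  pose Q := vec3 x y 1 *m invmx M.
  have QM : Q *m M = vec3 x y 1 by rewrite mulmxKV.
  have CQ : on_curve C Q by rewrite CE; apply/(on_curve_lsub uM); rewrite QM.
  have baseQ : base_point W Q.
    split; first exact: CQ.1.
    move=> F [_ [w Ww ->]]; have [m [n ->]] := spanW w Ww.
    rewrite /= evD !evZ -Cu CQ.2 -[X in _ + _ * ev X _](lsubK _ uM) ev_lsub QM
        -/G G0.
    by rewrite !mulr0 addr0.
  have /(proportional_mulmx uM) := uniqP Q baseQ; rewrite QM => xyP.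
  have [c _ /(congr1 (fun P : 'rV_3 => P 0 i2)) /eqP] :=
      proportional_trans xyP PM.
  by rewrite !mxE /= mulr0 oner_eq0.
have vE : v = mu *: C + nu *: lsub M ('X_i2 ^+ 3) :> {mpoly K[3]}.
  by rewrite -[LHS](lsubK _ uM) -/G GE lsubD !lsubZ -CE.
have ZE : lsub M ('X_i2 ^+ 3) = nu^-1 *: (v : {mpoly K[3]}) - (nu^-1 * mu) *: C.
  by rewrite vE scalerDr !scalerA mulVf // scale1r addrAC subrr add0r.
move=> F; split.
  case=> nzF [w Ww Fw]; have [m [n wE]] := spanW w Ww.
  exists (m + n * mu), (n * nu).
  have FE : F = lsub M ((m + n * mu) *: weier a b + (n * nu) *: 'X_i2 ^+ 3).
    rewrite Fw wE /= -Cu vE lsubD !lsubZ -CE scalerDr !scalerA scalerDl addrA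
        //.
  split=> //; apply: contraNT nzF;
      rewrite negb_or !negbK => /andP[/eqP e1 /eqP e2].
  by rewrite FE e1 e2 !scale0r addr0 (lsub_eq0 uM).
case=> m [n [nz_mn FE]].
split.
  rewrite FE (lsub_eq0 uM).
  apply: contraTneq nz_mn => e0.
  have ev_e0 Q := congr1 (fun H => ev H Q) e0.
  have := ev_e0 (vec3 1 0 0); have := ev_e0 (vec3 0 0 1).
  rewrite !evD !evZ !ev_weier3 !evXn !evX !vec3E !ev0 => e1 e2.
  have m0 : m = 0 by rewrite -[RHS]oppr0 -e2; ring.
  have n0 : n = 0 by rewrite -e1 m0; ring.
  by rewrite m0 n0 eqxx.
exists ((m - n / nu * mu) *: u + (n / nu) *: v).
  by rewrite memvD ?memvZ.
rewrite /= -Cu vE FE lsubD !lsubZ -CE scalerDr !scalerA addrA -scalerDl.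
by rewrite mulfVK // addrNK.
Qed.

End Pencil.

(** * The members of the pencil *)

Section EquianharmonicCubics.
Variable K : numClosedFieldType.

(** The substitution Y -> Y / u, Z -> u^2 Z turns b into u^6 b when a = 0. *)
Lemma isomorphic_weier_equianharmonic (s t : K) : s != 0 -> t != 0 ->
  isomorphic_curves (weier 0 s) (weier 0 t).
Proof.
move=> nz_s nz_t; pose u := 6.-root (s / t).
have u6 : u ^+ 6 = s / t by rewrite rootCK.
have nz_u : u != 0 by rewrite rootC_eq0 // mulf_neq0 ?invr_eq0.
pose D := rows3 (vec3 1 0 0) (vec3 0 u^-1 0) (vec3 0 0 (u ^+ 2)).
have uD : D \in unitmx.
  apply: unitmx_inj => P; rewrite {1}(vec3_eta P) mul_rows3 => e.
  have e0 := congr1 (fun P : 'rV_3 => P 0 i0) e.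
  have e1 := congr1 (fun P : 'rV_3 => P 0 i1) e.
  have e2 := congr1 (fun P : 'rV_3 => P 0 i2) e.
  move: e0 e1 e2; rewrite !mxE /= !mulr0 !addr0 !add0r => e0 e1 e2.
  apply: row3P; rewrite mxE; first by rewrite -e0 mulr1.
    by apply: (mulIf (_ : u^-1 != 0)); rewrite ?mul0r // invr_eq0.
  by apply: (mulIf (expf_neq0 2 nz_u)); rewrite mul0r.
suff -> : weier 0 s = lsub D (weier 0 t) by exact: isomorphic_curves_lsub.
have DX0 : lsub D 'X_i0 = 'X_i0.
  by rewrite lsubX sum3 !mxE /= !scale0r !addr0 scale1r.
have DX1 : lsub D 'X_i1 = u^-1 *: 'X_i1.
  by rewrite lsubX sum3 !mxE /= !scale0r addr0 add0r.
have DX2 : lsub D 'X_i2 = u ^+ 2 *: 'X_i2.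
  by rewrite lsubX sum3 !mxE /= !scale0r !add0r.
rewrite /weier !(lsubD, lsubB, lsubN, lsubZ, lsubM, lsubXn) DX0 DX1 DX2.
transitivity ((u^-1 ^+ 2 * u ^+ 2) *: ('X_i1 ^+ 2 * 'X_i2) - 'X_i0 ^+ 3
    - 0 *: ('X_i0 * 'X_i2 ^+ 2) - (t * u ^+ 6) *: 'X_i2 ^+ 3 : {mpoly K[3]}).
  by rewrite -exprMn mulVf // expr1n scale1r u6 (mulrC t) mulfVK.
by rewrite -!mul_mpolyC !(mpolyCM, mpolyC0, rmorphXn) /=; ring.
Qed.

End EquianharmonicCubics.

Section SingularMembers.
Variable K : numClosedFieldType.
Implicit Types (F G H : {mpoly K[3]}) (P Q : 'rV[K]_3) (c : K).
Variables (W : {vspace dhomog 3 K 3}) (M : 'M[K]_3) (a b : K) (L : {mpoly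
    K[3]}).
Hypotheses (uM : M \in unitmx) (pencilW : weier_pencil M a b W).
Hypothesis LM : proportional L (lsub M 'X_i2).

Local Notation E beta := (lsub M (weier a beta)).

Lemma cube_line : exists2 c, c != 0 & L ^+ 3 = lsub M (c *: 'X_i2 ^+ 3).
Proof.
case: LM => c nz_c ->; exists (c ^+ 3); first by rewrite expf_neq0.
by rewrite exprZn lsubZ lsubXn.
Qed.

Lemma member_cube : pencil_member W (L ^+ 3).
Proof.
have [c nz_c ->] := cube_line; apply/pencilW; exists 0, c.
by rewrite nz_c orbT scale0r add0r.
Qed.

Lemma member_weier beta : pencil_member W (E beta).
Proof.
apply/pencilW; exists 1, (b - beta); rewrite oner_eq0; split=> //;
    congr (lsub M _).
by rewrite /weier -!mul_mpolyC mpolyCB mpolyC1; ring.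
Qed.

(** Adding a multiple of Z^3 to a Weierstrass cubic changes only b. *)
Lemma memberP F : pencil_member W F ->
  proportional F (L ^+ 3) \/ exists beta, proportional F (E beta).
Proof.
move=> /pencilW[m [n [nz_mn ->]]].
have [m0 | nz_m] := eqVneq m 0; [left | right].
  have [c nz_c ->] := cube_line; exists (n / c).
    by rewrite mulf_neq0 ?invr_eq0 //; move: nz_mn; rewrite m0 eqxx.
  by rewrite m0 scale0r add0r !lsubZ scalerA mulfVK.
exists (b - n / m), m => //; rewrite -lsubZ; congr (lsub M _).
have -> : weier a (b - n / m) = weier a b + (n / m) *: 'X_i2 ^+ 3.
  by rewrite /weier -!mul_mpolyC mpolyCB; ring.
by rewrite [RHS]scalerDr scalerA mulrC mulfVK.
Qed.

Lemma reducible_member_cube : reducible (L ^+ 3).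
Proof.
have [c _ LE] := LM.
apply: (@reducible_cube _ L (vec3 1 0 0 *m invmx M)).
  by rewrite mulmx_unit_eq0 ?unitmx_inv // vec3_eq0 oner_eq0.
by rewrite LE evZ ev_lsub mulmxKV // evX vec3E mulr0.
Qed.

Lemma irreducible_member beta F : proportional F (E beta) -> ~ reducible F.
Proof.
move=> /proportional_sym FE /(reducible_proportional FE) /(reducible_lsub uM).
exact: weier_irreducible.
Qed.

Lemma reducible_memberP F : pencil_member W F ->
  reducible F <-> proportional F (L ^+ 3).
Proof.
move=> WF; split=> [redF | FL]; last first.
  exact: reducible_proportional FL reducible_member_cube.
by case: (memberP WF) => // -[beta /irreducible_member].
Qed.

Lemma singular_cube : singular_curve (L ^+ 3).
Proof.
have [c _ ->] := cube_line; apply/(singular_curve_lsub uM).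
exists (vec3 1 0 0); apply/singular_atP; split.
  by split; rewrite ?vec3_eq0 ?oner_eq0 // !evE vec3E; ring.
move=> Q; have -> : along (c *: 'X_i2 ^+ 3) (vec3 1 0 0) Q =
    poly3 0 0 0 (c * Q 0 i2 ^+ 3).
  by apply: poly_ext => t; rewrite horner_along horner_poly3 !evE !mxE /=; ring.
by rewrite coef_poly3.
Qed.

Lemma singular_memberP beta F : proportional F (E beta) ->
  singular_curve F <-> disc a beta = 0.
Proof.
move=> FE; apply: iff_trans (singular_curve_weier a beta).
apply: iff_trans (singular_curve_lsub uM _).
split; first exact: singular_curve_proportional (proportional_sym FE).
exact: singular_curve_proportional FE.
Qed.

(** The singular points of a Weierstrass cubic are off the line Z = 0, on
    which p lies. *)
Lemma singular_member_not_p P F Q : proportional (P *m M) (vec3 0 1 0) ->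
  pencil_member W F -> ~ reducible F -> singular_at F Q -> ~ proportional Q P.
Proof.
move=> PM WF irrF sQ QP; case: (memberP WF) => [/(reducible_memberP
    WF)//|[beta]].
case=> c nz_c FE; move: sQ; rewrite FE => /singular_atP[sQ1 sQ2].
have /(singular_at_lsub uM) : singular_at (E beta) Q.
  rewrite -[E beta]scale1r -(mulVf nz_c) -scalerA.
  apply: singular_at_scale; first by rewrite invr_eq0.
  exact/singular_atP.
have /(proportional_mulmx uM) QPM := QP.
have [d nz_d ->] := proportional_trans QPM PM.
rewrite (vec3_eta (d *: _)) => /singular_weierP[].
by rewrite !mxE /= mulr0 eqxx.
Qed.

(** The values of the second parameter that annihilate the discriminant are
    the two square roots of -4 a^3 / 27. *)
Lemma two_nodal : a != 0 -> singular_members_line_two_nodal W L.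
Proof.
move=> nz_a; split; first exact: member_cube.
pose s := sqrtC (- 4 * a ^+ 3 / 27).
have s2 : s ^+ 2 = - 4 * a ^+ 3 / 27 by rewrite sqrtCK.
have nz_s : s != 0.
  by rewrite -sqrf_eq0 s2 !mulf_neq0 ?invr_eq0 ?oppr_eq0 ?expf_neq0 ?pnatr_eq0.
have nodal t : t ^+ 2 = s ^+ 2 -> nodal_cubic (E t).
  move=> t2; apply: nodal_cubic_lsub => //; pose c := - 3 * t / (2 * a).
  have nz_t : t != 0 by rewrite -sqrf_eq0 t2 sqrf_eq0.
  have c2 : - 3 * c ^+ 2 = a.
    have -> : - 3 * c ^+ 2 = - 27 * t ^+ 2 / (4 * a ^+ 2) by rewrite /c; field.
    by rewrite t2 s2; field.
  have -> : a = - 3 * c ^+ 2 by [].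
  have -> : t = 2 * c ^+ 3.
    have -> : 2 * c ^+ 3 = - 2 / 3 * c * (- 3 * c ^+ 2) by field.
    by rewrite c2 /c; field.
  apply: nodal_cubic_weier.
  by rewrite /c !mulf_neq0 ?invr_eq0 ?mulf_neq0 ?oppr_eq0 ?pnatr_eq0.
exists (E s), (E (- s)); split.
- by split; exact: member_weier.
- by split; apply: nodal; rewrite ?sqrrN.
- move=> /(proportional_lsub uM)[c _ e].
  have ev_x t : ev (weier a t) (vec3 1 0 0) = - 1 by rewrite ev_weier3; ring.
  have ev_z t : ev (weier a t) (vec3 0 0 1) = - t by rewrite ev_weier3; ring.
  have := congr1 (fun F => ev F (vec3 1 0 0)) e.
  rewrite /= evZ !ev_x mulrN1 => /oppr_inj c1.
  have := congr1 (fun F => ev F (vec3 0 0 1)) e.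
  rewrite /= evZ !ev_z -c1 mul1r => /eqP.
  by rewrite opprK eq_sym -subr_eq0 opprK -mulr2n mulrn_eq0 (negPf nz_s).
move=> F WF; have sing t : t ^+ 2 = s ^+ 2 -> proportional F (E t) ->
    singular_curve F.
  by move=> t2 Ft; apply/(singular_memberP Ft); rewrite /disc t2 s2; field.
split=> [sF | [FL | Fs | Fs]]; last 3 first.
- exact: singular_curve_proportional FL singular_cube.
- exact: sing Fs.
- by apply: sing Fs; rewrite sqrrN.
case: (memberP WF) => [FL | [t Ft]]; first by constructor 1.
have /eqP : t ^+ 2 = s ^+ 2.
  move/(singular_memberP Ft): sF => d0.
  apply/eqP; rewrite -subr_eq0 s2 -(mulrI_eq0 _ (mulfI (_ : 27 != 0)))
      ?pnatr_eq0 //.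
  by rewrite -d0 /disc; apply/eqP; field.
by rewrite eqf_sqr => /orP[] /eqP t_s; rewrite t_s in Ft;
    [constructor 2|constructor 3].
Qed.

Lemma one_cuspidal : a = 0 -> singular_members_line_one_cuspidal W L.
Proof.
move=> a0; split; first exact: member_cube.
exists (E 0); split; first exact: member_weier.
  by rewrite a0; apply: cuspidal_cubic_lsub => //; exact: cuspidal_cubic_weier.
move=> F WF; split=> [sF | [FL | F0]]; last 2 first.
- exact: singular_curve_proportional FL singular_cube.
- by apply/(singular_memberP F0); rewrite /disc a0; ring.
case: (memberP WF) => [FL | [t Ft]]; [by left | right].
move/(singular_memberP Ft): sF => d0; suff -> : 0 = t by [].
apply/esym/eqP; rewrite -sqrf_eq0 -(mulrI_eq0 _ (mulfI (_ : 27 != 0)))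
    ?pnatr_eq0 //.
by rewrite -d0 /disc a0; apply/eqP; ring.
Qed.

(** In the first case there are two singular members besides the triple line,
    in the second one only one. *)
Lemma nodal_cuspidal_excl : singular_members_line_two_nodal W L ->
  singular_members_line_one_cuspidal W L -> False.
Proof.
case=> _ [F1 [F2 [[W1 W2] [[_ irr1 [P1 [? [? [[s1 _ _ _] _]]] _]]
  [_ irr2 [P2 [? [? [[s2 _ _ _] _]]] _]]] not12 _]]].
case=> _ [F0 [_ _ sing0]]; apply: not12.
have F10 : proportional F1 F0.
  by have /(sing0 _ W1)[/(reducible_memberP W1)|] : singular_curve F1 by
      exists P1.
have F20 : proportional F2 F0.
  by have /(sing0 _ W2)[/(reducible_memberP W2)|] : singular_curve F2 by
      exists P2.
exact: proportional_trans F10 (proportional_sym F20).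
Qed.

Lemma isotrivial_equianharmonic : a = 0 -> isotrivial W.
Proof.
move=> a0; have smooth_weier F : pencil_member W F -> smooth_curve F ->
    exists2 t, t != 0 & isomorphic_curves F (weier 0 t).
  move=> WF smF; case: (memberP WF) => [FL | [t Ft]].
    by case: smF; apply: singular_curve_proportional FL singular_cube.
  exists t.
    apply/eqP => t0; apply: smF; apply/(singular_memberP Ft).
    by rewrite /disc a0 t0; ring.
  apply: isomorphic_curves_trans (isomorphic_curves_proportional Ft) _.
  by rewrite -a0; exact: isomorphic_curves_lsub.
move=> F G WF smF WG smG.
have [s nz_s Fs] := smooth_weier F WF smF;
    have [t nz_t Gt] := smooth_weier G WG smG.
apply: isomorphic_curves_trans Fs _.
apply: isomorphic_curves_trans (isomorphic_weier_equianharmonic nz_s nz_t) _.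
exact: isomorphic_curves_sym.
Qed.

(** The members with parameters 0 and t, for t twice a square root of -4 a^3 /
    27, are smooth; they are not isomorphic, as the second parameter can
    vanish only for both or for neither. *)
Lemma not_isotrivial : a != 0 -> ~ isotrivial W.
Proof.
move=> nz_a isoW; pose t := 2 * sqrtC (- 4 * a ^+ 3 / 27).
have t2 : t ^+ 2 = - 16 * a ^+ 3 / 27 by rewrite exprMn sqrtCK; field.
have nz_t : t != 0.
  by rewrite -sqrf_eq0 t2 !mulf_neq0 ?invr_eq0 ?oppr_eq0 ?expf_neq0 ?pnatr_eq0.
have disc0 : disc a 0 != 0.
  have -> : disc a 0 = 4 * a ^+ 3 by rewrite /disc; ring.
  by rewrite mulf_neq0 ?expf_neq0 // pnatr_eq0.
have disct : disc a t != 0.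
  have -> : disc a t = - 12 * a ^+ 3 by rewrite /disc t2; field.
  by rewrite mulf_neq0 ?expf_neq0 // oppr_eq0 pnatr_eq0.
have smooth s : disc a s != 0 -> smooth_curve (E s).
  by move=> nz_d /(singular_memberP (proportional_refl _))/eqP; exact/negP.
have iso_0t := isoW _ _ (member_weier 0) (smooth 0 disc0) (member_weier t)
    (smooth t disct).
have : isomorphic_curves (weier a 0) (weier a t).
  apply: isomorphic_curves_trans (isomorphic_curves_sym _) _.
    exact: isomorphic_curves_lsub uM.
  exact: isomorphic_curves_trans iso_0t (isomorphic_curves_lsub _ uM).
case/(isomorphic_weier disc0) => c _ [_ e].
by move: nz_t; rewrite e mulr0 eqxx.
Qed.

End SingularMembers.

Theorem proposition8p1 (R : realType) (W : {vspace dhomog 3 R[i] 3})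
    (p : 'rV[R[i]]_3) (C : {mpoly R[i][3]}) :
  \dim W = 2%N ->
  only_base_point W p ->
  general_member W (@smooth_curve R[i]) ->
  (forall F, pencil_member W F -> smooth_curve F -> flex F p) ->
  pencil_member W C -> smooth_curve C ->
  let L := tangent_line C p in
  [/\ (* (i) *)
      pencil_member W (L ^+ 3) /\
      (forall F, pencil_member W F -> (reducible F <-> proportional F (L ^+ 3))),
      (* (ii) *)
      (forall F P, pencil_member W F -> ~ reducible F ->
         node F P \/ cusp F P -> ~ proportional P p) &
      (* (iii) *)
      [/\ singular_members_line_two_nodal W L \/
            singular_members_line_one_cuspidal W L,
          singular_members_line_two_nodal W L <-> ~ isotrivial W &
          singular_members_line_one_cuspidal W L <-> isotrivial W]].
Proof.
move=> dimW baseW _ flexW WC smC L.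
have [M [a [b [uM pencilW pM LM]]]] :=
  pencil_weier dimW baseW WC smC (flexW C WC smC).
split.
- split; first exact: member_cube pencilW LM.
  by move=> F; exact: reducible_memberP uM pencilW LM F.
- move=> F P WF irrF sing; apply: (singular_member_not_p uM pencilW LM pM WF irrF).
  by case: sing => [[l1 [l2 [[]]]] | [l [[]]]].
have excl := nodal_cuspidal_excl uM pencilW LM.
have [a0 | nz_a] := eqVneq a 0.
  have cusp1 := one_cuspidal uM pencilW LM a0.
  have iso := isotrivial_equianharmonic uM pencilW LM a0.
  by split; [right | split=> // nodal2; case: (excl nodal2 cusp1) | split].
have nodal2 := two_nodal uM pencilW LM nz_a.
have niso := not_isotrivial uM pencilW nz_a.
by split; [left | split | split=> // cusp1; case: (excl nodal2 cusp1)].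
Qed.
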